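(* Let $\Phi(z)$ be a low-rank $(m+p)\times(m+p)$ rational spectral density of rank $m$, partitioned as $$\Phi(z)=\begin{bmatrix}\Phi_{11}(z)&\Phi_{12}(z)\\ \Phi_{21}(z)&\Phi_{22}(z)\end{bmatrix},$$ where $\Phi_{11}$ is $m\times m$ and full-rank. Let $G_1(z)$ be a minimum-phase square spectral factor of $\Phi_{11}(z)$, let $H(z)=\Phi_{21}(z)\Phi_{11}(z)^{-1}$, and let the proper function $G_1(z)^\top H(z)^\top$ have a minimal realization $$G_1(z)^\top H(z)^\top=\left[\begin{array}{cc|c}A_u & A_{us} & B_u \\ 0 & A_s & B_s\\ \hline C_u & C_s&D\end{array}\right]$$ with square invertible state matrix $\begin{bmatrix}A_u&A_{us}\\0&A_s\end{bmatrix}$, where the eigenvalues of $A_u$ and $A_s$ correspond respectively to the unstable and stable poles of $G_1(z)^\top H(z)^\top$. Then the Stein equation $$X-A_u^*XA_u-C_u^*C_u=0$$ has a unique invertible Hermitian solution $X$, and all the minimum-phase full-column-rank spectral factors $W(z)$ of $\Phi(z)$ are given by $$W(z)=\begin{bmatrix}G_1(z)Q_1(z)\\ W_2(z)\end{bmatrix},$$ with $$W_2(z)=\left[\begin{array}{cc|c} A_u+R_u & A_{us}+R_s & B_u+R_D \\ 0 & A_s & B_s \\ \hline PC_u & PC_s & PD \end{array}\right]^\top,\qquad Q_1(z)=\left[\begin{array}{c|c} A_u+R_u & (1-z)M \\ \hline PC_u & P \end{array}\right]^\top,$$ where $$R_s=(1-z)MC_s,\quad R_u=(1-z)MC_u,\quad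 R_D=(1-z)MD,\quad M=-X^{-1}(I-A_u)^{-*}C_u^*,$$ and $P$ is any $m\times m$ unitary matrix. The pair $(Q_1,W_2)$ is unique when the unitary matrix $P$ has been chosen.
   Context: Here $m>0$, $p\ge 0$ are integers. A rational spectral density (discrete time) is a rational matrix function $\Phi(z)$ that is Hermitian positive semidefinite on the unit circle and has no poles there; its rank is its rank as a rational matrix, and $\Phi_{12}=\Phi_{21}^*$. For a rational matrix function, $W(z)^*=\overline{W(\bar z^{-1})}^{\top}$ (the conjugate transpose of $W(z)$ on the unit circle); for a constant matrix, $A^*$ is the conjugate transpose and $A^{-*}=(A^{-1})^*$. A spectral factor of $\Phi$ is a $W$ with $\Phi=WW^*$ (likewise $\Phi_{11}=G_1G_1^*$). A rational spectral factor is minimum-phase (equivalently, outer) if it has all its poles in the open unit disc and all its zeros in the closed unit disc (so it has no pole or zero at infinity). A point $\alpha$ in the region where $W$ is analytic is a (right) zero of $W$ if there is a nonzero vector $v$ with $W(\alpha)v=0$. Notation for realizations: $$\left[\begin{array}{c|c}A &B\\ \hline C&D\end{array}\right]:= C(zI-A)^{-1}B+D,$$ used also when the entries $A,B$ themselves depend on $z$. Unstable poles are those in the exterior of the closed unit disc (which contains infinity); stable poles are those in the closed unit disc. *)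

(* Defs.v *)
From mathcomp Require Export all_boot all_order all_algebra.
From mathcomp Require Export fraction sesquilinear spectral.
From mathcomp Require Export complex reals.

Set Implicit Arguments.
Unset Strict Implicit.
Unset Printing Implicit Defensive.

Export Order.TTheory GRing.Theory Num.Theory.
Local Open Scope ring_scope.
Local Open Scope sesquilinear_scope.

Notation ratfun C := {fraction {poly C}}.
Local Notation "x %:F" := (tofrac x) : ring_scope.

Section Defs.
Variable C : numClosedFieldType.
Local Notation F := (ratfun C).

Definition rconst (c : C) : F := (c%:P)%:F.
Definition rvar : F := ('X : {poly C})%:F.

(* [Some a] is the finite point a and [None] is the point at infinity. *)
Definition point := option C.

(* f is analytic at the point z, with value v.  The fraction p / q need not be
   reduced, so removable singularities are not poles. *)
Definition has_value (f : F) (z : point) (v : C) : Prop :=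
  exists p q : {poly C}, f = p%:F / q%:F /\
    match z with
    | Some a => q.[a] != 0 /\ v = p.[a] / q.[a]
    | None => [/\ q != 0, (size p <= size q)%N
                & v = p`_(size q).-1 / lead_coef q]
    end.

Definition mx_value m n (W : 'M[F]_(m, n)) (z : point) (V : 'M[C]_(m, n)) :=
  forall i j, has_value (W i j) z (V i j).

Definition is_pole m n (W : 'M[F]_(m, n)) (z : point) : Prop :=
  ~ exists V, mx_value W z V.

Definition is_zero m n (W : 'M[F]_(m, n)) (z : point) : Prop :=
  exists (V : 'M[C]_(m, n)) (v : 'cV[C]_n),
    [/\ mx_value W z V, v != 0 & V *m v = 0].

Definition in_open_disc (z : point) : bool :=
  if z is Some a then `|a| < 1 else false.
Definition in_closed_disc (z : point) : bool :=
  if z is Some a then `|a| <= 1 else false.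

(* For p = \sum_k p_k z^k this is \sum_k conj(p_k) z^{-k}. *)
Definition para_poly (p : {poly C}) : F :=
  (map_poly (fun c => rconst c^*) p).[rvar^-1].

(* f(z) |-> conj (f (1 / conj z)); the result does not depend on the fraction
   representing f, as para_poly is an injective ring morphism. *)
Definition para (f : F) : F :=
  let r := repr f in para_poly \n_r / para_poly \d_r.

Definition paramx m n (W : 'M[F]_(m, n)) : 'M[F]_(n, m) := map_mx para W^T.

Definition psdmx n (A : 'M[C]_n) : Prop :=
  A \is hermsymmx /\ forall v : 'cV[C]_n, 0 <= (v^t* *m A *m v) 0 0.

Definition spectral_density n (Phi : 'M[F]_n) : Prop :=
  forall a : C, `|a| = 1 -> exists2 V, mx_value Phi (Some a) V & psdmx V.

Definition spectral_factor n k (Phi : 'M[F]_n) (W : 'M[F]_(n, k)) : Prop :=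
  Phi = W *m paramx W.

Definition minimum_phase m n (W : 'M[F]_(m, n)) : Prop :=
  (forall z, is_pole W z -> in_open_disc z) /\
  (forall z, is_zero W z -> in_closed_disc z).

(* The entries of A, B, C, D may depend on z. *)
Definition transfer n k l (A : 'M[F]_n) (B : 'M[F]_(n, k))
    (Cm : 'M[F]_(l, n)) (D : 'M[F]_(l, k)) : 'M[F]_(l, k) :=
  Cm *m invmx (rvar%:M - A) *m B + D.

Definition realizes n k l (T : 'M[F]_(l, k)) (A : 'M[C]_n)
    (B : 'M[C]_(n, k)) (Cm : 'M[C]_(l, n)) (D : 'M[C]_(l, k)) : Prop :=
  T = transfer (map_mx rconst A) (map_mx rconst B)
               (map_mx rconst Cm) (map_mx rconst D).

Definition minimal_realization n k l (T : 'M[F]_(l, k)) (A : 'M[C]_n)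
    (B : 'M[C]_(n, k)) (Cm : 'M[C]_(l, n)) (D : 'M[C]_(l, k)) : Prop :=
  realizes T A B Cm D /\
  forall n' (A' : 'M[C]_n') (B' : 'M[C]_(n', k)) (C' : 'M[C]_(l, n'))
    (D' : 'M[C]_(l, k)), realizes T A' B' C' D' -> (n <= n')%N.

Record split_system (l k : nat) := SplitSystem {
  nu : nat;
  ns : nat;
  Au : 'M[C]_nu;
  Aus : 'M[C]_(nu, ns);
  As : 'M[C]_ns;
  Bu : 'M[C]_(nu, k);
  Bs : 'M[C]_(ns, k);
  Cu : 'M[C]_(l, nu);
  Cs : 'M[C]_(l, ns);
  Dm : 'M[C]_(l, k)
}.

Definition split_A l k (S : split_system l k) : 'M[C]_(nu S + ns S) :=
  block_mx (Au S) (Aus S) 0 (As S).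

Definition split_realization l k (T : 'M[F]_(l, k)) (S : split_system l k) :=
  [/\ minimal_realization T (split_A S) (col_mx (Bu S) (Bs S))
        (row_mx (Cu S) (Cs S)) (Dm S),
      split_A S \in unitmx,
      forall a, eigenvalue (Au S) a <->
                is_pole T (Some a) /\ ~~ in_closed_disc (Some a)
    & forall a, eigenvalue (As S) a <->
                is_pole T (Some a) /\ in_closed_disc (Some a)].

Section Formulas.
Variables (l k : nat) (S : split_system l k).

Definition stein_solution (X : 'M[C]_(nu S)) : Prop :=
  [/\ X - (Au S)^t* *m X *m Au S - (Cu S)^t* *m Cu S = 0,
      X \is hermsymmx & X \in unitmx].

Variables (X : 'M[C]_(nu S)) (P : 'M[C]_l).

Definition M_of : 'M[C]_(nu S, l) :=
  - (invmx X *m (invmx (1%:M - Au S))^t* *m (Cu S)^t*).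

Local Notation cst := (map_mx rconst).

Definition Rs_of : 'M[F]_(nu S, ns S) := (1 - rvar) *: cst (M_of *m Cs S).
Definition Ru_of : 'M[F]_(nu S) := (1 - rvar) *: cst (M_of *m Cu S).
Definition RD_of : 'M[F]_(nu S, k) := (1 - rvar) *: cst (M_of *m Dm S).

Definition W2_of : 'M[F]_(k, l) :=
  (transfer (block_mx (cst (Au S) + Ru_of) (cst (Aus S) + Rs_of)
                      0                    (cst (As S)))
            (col_mx (cst (Bu S) + RD_of) (cst (Bs S)))
            (row_mx (cst (P *m Cu S)) (cst (P *m Cs S)))
            (cst (P *m Dm S)))^T.

Definition Q1_of : 'M[F]_l :=
  (transfer (cst (Au S) + Ru_of) ((1 - rvar) *: cst M_of)
            (cst (P *m Cu S)) (cst P))^T.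

End Formulas.

End Defs.

(* Main.v *)
Require Import Defs.
From HB Require Import structures.
From mathcomp Require Import boolp ring.

Set Implicit Arguments.
Unset Strict Implicit.
Unset Printing Implicit Defensive.

Local Open Scope ring_scope.
Local Open Scope sesquilinear_scope.

(** Let T = G1^T H^T, let z be the variable, and write F~ for the para-Hermitian
    conjugate of F.  The square function
      K(z) = I - Cu (z I - Au)^-1 (1 - z) M,
    called [allpass] below, governs everything.  Two identities relate it to the
    formulas of the theorem.

    - The Stein equation makes K para-unitary.  It factors the closed-loop pencil
      z I - Au - (1 - z) M Cu as a product of constant invertible matrices and of
      I - z Au^* ([pencil_factor]), and this gives K^-1 = K~ ([para_allpass]).
    - Adding the feedback (1 - z) M to a realization of T multiplies T by K^-1 on
      the left ([transfer_feedback]).  Hence Q1^T = P K~ ([Q1_ofE]) and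
      W2^T = Q1^T T ([W2_ofE]), that is, W2 = H G1 Q1 ([W2_of_factor]).

    So W is [I; H] G1 Q1 with Q1 para-unitary.  As Phi has the rank of Phi11, it
    equals [I; H] Phi11 [I; H]~ ([PhiE]), and W is a spectral factor.

    W is minimum-phase.  K is analytic in the closed disc because Au is
    antistable, so K~ is analytic outside the open disc; the poles of T outside
    the closed disc disappear from W2, since the closed-loop pencil is invertible
    there, and T has no poles on the circle because (H G1) (H G1)~ is the block
    Phi22 ([HG1_circle]).  A zero of W in the exterior would be a common left
    zero of Q1^T and W2^T, and with the realizations of both this yields a left
    eigenvector of the state matrix orthogonal to the input matrix, against
    minimality ([no_common_zero]).

    Conversely, any minimum-phase factor of full rank is [I; H] W1 with
    W1 W1~ = Phi11, and V = (G1 Q1)^-1 W1 is para-unitary.  V and V~ are analytic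
    in the exterior, as both tall factors have left invertible values there; by
    reflection V is analytic in the disc; on the circle its rows have norm one,
    so it has no poles.  A rational function without poles on the sphere is
    constant, and V is absorbed in P ([minimum_phase_unique]).

    Two systems that realize T give minimum-phase factors, hence functions Q1
    that differ by a constant unitary matrix.  This matrix is I because Q1(1) is
    P^T for both ([Q1_W2_unique]).

    The unique solvability of the Stein equation compares eigenvalues of Au^* and
    Au^-1 ([stein_homogeneous]); the invertibility of X comes from observability,
    by splitting off eigenvectors ([stein_unit]).  No limits occur: analyticity
    at a point means membership in the local ring of that point. *)

(** * Values of rational functions *)

Section Values.
Variable C : numClosedFieldType.
Local Notation F := (ratfun C).
Local Notation tf := (@tofrac {poly C}).
Implicit Types (f g : F) (p q : {poly C}) (a c v w : C) (z : point C).

Fact rconst_zmod : zmod_morphism (@rconst C).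
Proof. by move=> x y; rewrite /rconst polyCB rmorphB. Qed.

Fact rconst_monoid : monoid_morphism (@rconst C).
Proof. by split=> [|x y]; rewrite /rconst ?polyCM ?rmorphM ?rmorph1. Qed.
HB.instance Definition _ := GRing.isZmodMorphism.Build C F (@rconst C) rconst_zmod.
HB.instance Definition _ := GRing.isMonoidMorphism.Build C F (@rconst C) rconst_monoid.

(** At infinity p / q is read off from the coefficients of degree n of p and q,
    where n bounds both degrees; products add these bounds. *)
Lemma sizeM_top p q n k : (size p <= n.+1)%N -> (size q <= k.+1)%N ->
  (size (p * q)%R <= (n + k).+1)%N.
Proof.
move=> sp sq; apply: leq_trans (size_polyMleq _ _) _.
by rewrite -subn1 leq_subLR (leq_trans (leq_add sp sq)) // addSn addnS.
Qed.

Lemma coefM_top p q n k : (size p <= n.+1)%N -> (size q <= k.+1)%N ->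
  (p * q)`_(n + k) = p`_n * q`_k.
Proof.
move=> sp sq; rewrite coefM.
have ltn_ : (n < (n + k).+1)%N by rewrite ltnS leq_addr.
rewrite (bigD1 (Ordinal ltn_)) //= addKn big1 ?addr0 // => i ne_in.
have [lt_in|lt_ni|eq_in] := ltngtP i n.
- rewrite [q`_ _]nth_default ?mulr0 // (leq_trans sq) //.
  by rewrite ltn_subRL ltn_add2r.
- by rewrite nth_default ?mul0r // (leq_trans sp).
- by case/eqP: ne_in; apply: val_inj.
Qed.

(** A degree bound n common to p and q makes the point at infinity look like a
    finite one: the coefficient of degree n plays the part of evaluation. *)
Lemma has_value_infP f v : has_value f None v <->
  exists p q n, [/\ f = tf p / tf q, (size p <= n.+1)%N, (size q <= n.+1)%N,
                    q`_n != 0 & v = p`_n / q`_n].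
Proof.
split=> [[p [q [-> [q0 spq ->]]]]|[p [q [n [-> sp sq qn ->]]]]].
  exists p, q, (size q).-1; rewrite -lead_coefE lead_coef_eq0 prednK ?size_poly_gt0 //.
exists p, q; split=> //.
have sqE : size q = n.+1.
  by apply/eqP; rewrite eqn_leq sq ltnNge; apply: contra qn => /leq_sizeP->.
by rewrite sqE lead_coefE sqE; split=> //; apply: contra qn => /eqP->; rewrite coef0.
Qed.

Lemma has_value_finP f a v : has_value f (Some a) v <->
  exists p q, [/\ f = tf p / tf q, q.[a] != 0 & v = p.[a] / q.[a]].
Proof.
by split=> [[p [q [-> [q0 ->]]]]|[p [q [-> q0 ->]]]]; exists p, q.
Qed.

Lemma horner_neq0 p a : p.[a] != 0 -> tf p != 0.
Proof. by apply: contra; rewrite tofrac_eq0 => /eqP->; rewrite horner0. Qed.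

Lemma coef_neq0 p n : p`_n != 0 -> tf p != 0.
Proof. by apply: contra; rewrite tofrac_eq0 => /eqP->; rewrite coef0. Qed.

Lemma eq_tofrac_div p q p' q' : tf q != 0 -> tf q' != 0 ->
  tf p / tf q = tf p' / tf q' -> p * q' = p' * q.
Proof.
move=> q0 q'0 /eqP; rewrite (eqr_div _ _ q0 q'0) -(tofracM p q') -(tofracM p' q).
by rewrite tofrac_eq => /eqP.
Qed.

Lemma tofrac_divD p q p' q' : tf q != 0 -> tf q' != 0 ->
  tf p / tf q + tf p' / tf q' = tf (p * q' + p' * q) / tf (q * q').
Proof. by move=> q0 q'0; rewrite (addf_div _ _ q0 q'0) !rmorphD !rmorphM. Qed.

Lemma tofrac_divM p q p' q' :
  tf p / tf q * (tf p' / tf q') = tf (p * p') / tf (q * q').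
Proof. by rewrite mulf_div !rmorphM. Qed.

Lemma has_value_uniq f z v w : has_value f z v -> has_value f z w -> v = w.
Proof.
case: z => [a|].
  move=> /has_value_finP[p [q [-> q0 ->]]] /has_value_finP[p' [q' [e q'0 ->]]].
  have := eq_tofrac_div (horner_neq0 q0) (horner_neq0 q'0) e.
  by move/(congr1 (horner^~ a)); rewrite !hornerM => /eqP e'; apply/eqP; rewrite eqr_div.
move=> /has_value_infP[p [q [n [-> sp sq q0 ->]]]] /has_value_infP.
move=> [p' [q' [n' [e sp' sq' q'0 ->]]]].
have := eq_tofrac_div (coef_neq0 q0) (coef_neq0 q'0) e.
move/(congr1 (fun r : {poly C} => r`_(n + n'))); rewrite coefM_top // addnC coefM_top //.
by move=> /eqP e'; apply/eqP; rewrite eqr_div.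
Qed.

Lemma has_value_const c z : has_value (rconst c) z c.
Proof.
exists c%:P, 1; rewrite rmorph1 divr1; split=> //.
case: z => [a|]; first by rewrite !hornerE oner_neq0 divr1.
by rewrite size_poly1 size_polyC leq_b1 lead_coef1 coefC divr1 oner_neq0.
Qed.

Lemma has_valueD f g z v w :
  has_value f z v -> has_value g z w -> has_value (f + g) z (v + w).
Proof.
case: z => [a|].
  move=> /has_value_finP[p [q [-> q0 ->]]] /has_value_finP[p' [q' [-> q'0 ->]]].
  apply/has_value_finP; exists (p * q' + p' * q), (q * q').
  split; first exact: tofrac_divD (horner_neq0 q0) (horner_neq0 q'0).
    by rewrite hornerM mulf_neq0.
  by rewrite hornerD !hornerM addf_div.
move=> /has_value_infP[p [q [n [-> sp sq q0 ->]]]] /has_value_infP.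
move=> [p' [q' [n' [-> sp' sq' q'0 ->]]]].
apply/has_value_infP; exists (p * q' + p' * q), (q * q'), (n + n')%N.
split; first exact: tofrac_divD (coef_neq0 q0) (coef_neq0 q'0).
- rewrite (leq_trans (size_polyD _ _)) // geq_max.
  by rewrite sizeM_top //= mulrC sizeM_top.
- exact: sizeM_top.
- by rewrite coefM_top // mulf_neq0.
- by rewrite coefD [p' * q]mulrC !coefM_top // addf_div // [p'`_ _ * _]mulrC.
Qed.

Lemma has_valueM f g z v w :
  has_value f z v -> has_value g z w -> has_value (f * g) z (v * w).
Proof.
case: z => [a|].
  move=> /has_value_finP[p [q [-> q0 ->]]] /has_value_finP[p' [q' [-> q'0 ->]]].
  apply/has_value_finP; exists (p * p'), (q * q').
  by split; rewrite ?tofrac_divM ?hornerM ?mulf_neq0 ?mulf_div.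
move=> /has_value_infP[p [q [n [-> sp sq q0 ->]]]] /has_value_infP.
move=> [p' [q' [n' [-> sp' sq' q'0 ->]]]].
apply/has_value_infP; exists (p * p'), (q * q'), (n + n')%N.
by split; rewrite ?tofrac_divM ?sizeM_top ?coefM_top ?mulf_neq0 ?mulf_div.
Qed.

Lemma has_valueV f z v : has_value f z v -> v != 0 -> has_value f^-1 z v^-1.
Proof.
case: z => [a|].
  move=> /has_value_finP[p [q [-> q0 ->]]].
  rewrite mulf_eq0 invr_eq0 (negPf q0) orbF => p0.
  by apply/has_value_finP; exists q, p; rewrite !invf_div.
move=> /has_value_infP[p [q [n [-> sp sq q0 ->]]]].
rewrite mulf_eq0 invr_eq0 (negPf q0) orbF => p0.
by apply/has_value_infP; exists q, p, n; rewrite !invf_div.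
Qed.

Lemma has_value_neq0 f z v : has_value f z v -> v != 0 -> f != 0.
Proof.
move=> fv; apply: contra => /eqP f0; apply/eqP; apply: has_value_uniq fv _.
by rewrite f0 -(rmorph0 (@rconst C)); apply: has_value_const.
Qed.

Lemma has_valueN f z v : has_value f z v -> has_value (- f) z (- v).
Proof.
move=> fv; rewrite -mulN1r -[- v]mulN1r -(rmorph1 (@rconst C)) -rmorphN.
by apply: has_valueM fv; apply: has_value_const.
Qed.

Lemma has_valueB f g z v w :
  has_value f z v -> has_value g z w -> has_value (f - g) z (v - w).
Proof. by move=> fv gw; apply: has_valueD fv (has_valueN gw). Qed.

Lemma has_value0 z : has_value (0 : F) z 0.
Proof. by rewrite -(rmorph0 (@rconst C)); apply: has_value_const. Qed.

Lemma has_value1 z : has_value (1 : F) z 1.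
Proof. by rewrite -(rmorph1 (@rconst C)); apply: has_value_const. Qed.

Lemma has_value_sum (I : finType) (f : I -> F) z (v : I -> C) :
  (forall i, has_value (f i) z (v i)) -> has_value (\sum_i f i) z (\sum_i v i).
Proof.
move=> fv; elim/big_rec2: _ => [|i x y _ xy]; first exact: has_value0.
exact: has_valueD (fv i) xy.
Qed.

Lemma has_value_prod (I : finType) (f : I -> F) z (v : I -> C) :
  (forall i, has_value (f i) z (v i)) -> has_value (\prod_i f i) z (\prod_i v i).
Proof.
move=> fv; elim/big_rec2: _ => [|i x y _ xy]; first exact: has_value1.
exact: has_valueM (fv i) xy.
Qed.

Lemma has_valueX f z v n : has_value f z v -> has_value (f ^+ n) z (v ^+ n).
Proof.
move=> fv; elim: n => [|n IHn]; first exact: has_value1.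
by rewrite !exprS; apply: has_valueM.
Qed.

Lemma has_value_poly p a : has_value (tf p) (Some a) p.[a].
Proof.
apply/has_value_finP; exists p, 1.
by rewrite rmorph1 !hornerE !divr1; split=> //; apply: oner_neq0.
Qed.

Lemma has_value_var a : has_value (rvar C) (Some a) a.
Proof. by have := has_value_poly 'X a; rewrite hornerX. Qed.

Lemma has_value_varV : has_value (rvar C)^-1 None 0.
Proof.
exists 1, 'X; rewrite rmorph1 div1r; split=> //.
by rewrite polyX_eq0 size_polyX size_poly1 lead_coefX coef1 divr1.
Qed.

Lemma rvar_neq0 : rvar C != 0.
Proof. by rewrite /rvar tofrac_eq0 polyX_eq0. Qed.

(** This lowers the order of a pole by one in [analytic_of_sum_para]. *)
Lemma has_value_div_root f a : has_value f (Some a) 0 ->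
  exists v, has_value (f / (rvar C - rconst a)) (Some a) v.
Proof.
move=> /has_value_finP[p [q [-> q0 /esym/eqP]]].
rewrite mulf_eq0 invr_eq0 (negPf q0) orbF => /factor_theorem[r ->].
exists (r.[a] / q.[a]); apply/has_value_finP; exists r, q; split=> //.
rewrite /rvar /rconst -rmorphB rmorphM /= mulrAC mulfK //.
by rewrite tofrac_eq0 polyXsubC_eq0.
Qed.

Lemma ratfun_repr f : f = tf \n_(repr f) / tf \d_(repr f).
Proof.
rewrite -{1}[f]reprK; set r := repr f; have d0 : \d_r != 0 by exact: denom_ratioP.
unlock tofrac; rewrite -[_^-1]FracField.pi_inv -[RHS]FracField.pi_mul.
apply/eqmodP; rewrite /= FracField.equivfE /FracField.mulf /FracField.invf.
by rewrite !numden_Ratio ?mulr1 ?mul1r ?oner_neq0 // mulrC.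
Qed.

End Values.

(** * Para-Hermitian conjugation *)

Section Circle.
Variable C : numClosedFieldType.
Implicit Types (p : {poly C}) (a : C).

(** The Cayley transforms (n + i) / (n - i) of the natural numbers are infinitely
    many points of the circle, so values on the circle determine a rational
    function. *)
Lemma unit_circle_non_root p : p != 0 -> exists2 a, `|a| = 1 & p.[a] != 0.
Proof.
move=> p0; pose u (n : nat) : C := (n%:R + 'i) / (n%:R - 'i).
have den0 n : n%:R - 'i != 0 :> C.
  apply/eqP => /(congr1 (fun x => 'Im x)) /eqP.
  by rewrite raddfB raddf0 /= Im_i (Creal_ImP _ _) ?realn // sub0r oppr_eq0 oner_eq0.
have normu n : `|u n| = 1.
  rewrite /u; have -> : n%:R + 'i = (n%:R - 'i)^* :> C.
    by rewrite rmorphB /= conjCi opprK rmorph_nat.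
  by rewrite normf_div norm_conjC divff // normr_eq0.
have u_inj : injective u.
  move=> n k /eqP; rewrite eqr_div // => /eqP e.
  have : 'i * 2%:R * (n%:R - k%:R)
      = (k%:R + 'i) * (n%:R - 'i) - (n%:R + 'i) * (k%:R - 'i) :> C by ring.
  rewrite e subrr; move/eqP; rewrite !mulf_eq0 (negPf (neq0Ci C)) pnatr_eq0 /=.
  by rewrite subr_eq0 eqr_nat => /eqP.
have [[n _ pu]|nroot] := pselect (exists2 n, (n < size p)%N & ~~ root p (u n)).
  by exists (u n).
exfalso; pose s := [seq u n | n <- iota 0 (size p)].
have := @max_poly_roots C p s p0; rewrite size_map size_iota ltnn => sP.
suff: false by []; apply: sP; last by rewrite map_inj_uniq ?iota_uniq.
apply/allP => _ /mapP[n + ->]; rewrite mem_iota /= add0n => ltn.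
by apply: contrapT => /negP nr; apply: nroot; exists n.
Qed.

End Circle.

Section Para.
Variable C : numClosedFieldType.
Local Notation F := (ratfun C).
Local Notation tf := (@tofrac {poly C}).
Implicit Types (f g : F) (p q : {poly C}) (a c v w : C) (z : point C).

(** The map a |-> 1 / conj a of the Riemann sphere: [para f] takes at the
    reflected point the conjugate of the value of [f]. *)
Definition reflect_point z : point C :=
  if z is Some a then if a == 0 then None else Some (a^*)^-1 else Some 0.

Lemma reflect_pointK : involutive reflect_point.
Proof.
case=> [a|] /=; last by rewrite eqxx.
have [->|a0] := eqVneq a 0; first by [].
by rewrite /= invr_eq0 conjC_eq0 (negPf a0) fmorphV /= conjCK invrK.
Qed.

Lemma reflect_circle a : `|a| = 1 -> reflect_point (Some a) = Some a.
Proof.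
move=> a1; have a0 : a != 0 by rewrite -normr_gt0 a1.
have ac0 : a^* != 0 by rewrite conjC_eq0.
rewrite /= (negPf a0); congr Some; apply: (mulIf ac0).
by rewrite mulVf // -normCK a1 expr1n.
Qed.

Lemma para_polyE p :
  para_poly p = horner_eval (rvar C)^-1 (map_poly (@rconst C \o Num.conj) p).
Proof. by []. Qed.

Fact para_poly_zmod : zmod_morphism (@para_poly C).
Proof. by move=> p q; rewrite !para_polyE !rmorphB. Qed.

Fact para_poly_monoid : monoid_morphism (@para_poly C).
Proof. by split=> [|p q]; rewrite !para_polyE ?rmorphM ?rmorph1. Qed.
HB.instance Definition _ :=
  GRing.isZmodMorphism.Build {poly C} F (@para_poly C) para_poly_zmod.
HB.instance Definition _ :=
  GRing.isMonoidMorphism.Build {poly C} F (@para_poly C) para_poly_monoid.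

Lemma para_polyC c : para_poly c%:P = rconst c^*.
Proof. by rewrite para_polyE map_polyC /horner_eval hornerC. Qed.

Lemma para_polyX : para_poly 'X = (rvar C)^-1.
Proof. by rewrite para_polyE map_polyX /horner_eval hornerX. Qed.

Lemma has_value_varV_reflect a :
  has_value (rvar C)^-1 (reflect_point (Some a)) a^*.
Proof.
rewrite /=; have [->|a0] := eqVneq; first by rewrite conjC0; exact: has_value_varV.
rewrite -[X in has_value _ _ X]invrK; apply: has_valueV; first exact: has_value_var.
by rewrite invr_eq0 conjC_eq0.
Qed.

Lemma has_value_para_poly p a :
  has_value (para_poly p) (reflect_point (Some a)) (p.[a])^*.
Proof.
elim/poly_ind: p => [|p c IHp].
  by rewrite rmorph0 horner0 conjC0; apply: has_value0.
rewrite rmorphD rmorphM /= para_polyC para_polyX hornerMXaddC rmorphD rmorphM.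
apply: has_valueD (has_value_const _ _).
exact: has_valueM IHp (has_value_varV_reflect a).
Qed.

(** The product is the polynomial with conjugate coefficients in reverse order. *)
Lemma has_value_para_poly_top p n : (size p <= n.+1)%N ->
  has_value (para_poly p * rvar C ^+ n) (Some 0) (p`_n)^*.
Proof.
elim/poly_ind: p n => [|p c IHp] n.
  by move=> _; rewrite rmorph0 mul0r coef0 conjC0; apply: has_value0.
rewrite rmorphD rmorphM /= para_polyC para_polyX coefD coefMX coefC.
case: n => [|n].
  rewrite size_MXaddC; case: eqP => [-> _|//].
    rewrite rmorph0 mul0r !add0r mulr1; exact: has_value_const.
  by rewrite ltnS leqn0 size_poly_eq0 => _ /eqP->;
     rewrite rmorph0 mul0r !add0r mulr1; exact: has_value_const.
move=> sp; rewrite mulrDl -mulrA exprS (mulKf (rvar_neq0 C)) /= addr0.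
rewrite -[X in has_value _ _ X]addr0; apply: has_valueD.
  apply: IHp; move: sp; rewrite size_MXaddC.
  by case: eqP => [->|_]; rewrite ?size_poly0.
rewrite -[X in has_value _ _ X](mulr0 (c^*)).
apply: has_valueM; first exact: has_value_const.
rewrite -[X in has_value _ _ X](mul0r (0 ^+ n)).
by apply/has_valueM/has_valueX; exact: has_value_var.
Qed.

Lemma para_poly_eq0 p : (para_poly p == 0) = (p == 0).
Proof.
apply/eqP/eqP => [pp0|->]; last exact: rmorph0.
apply/eqP; apply/negPn/negP => /unit_circle_non_root[a _].
by rewrite -conjC_eq0 => /(has_value_neq0 (has_value_para_poly p a)); rewrite pp0 eqxx.
Qed.

Lemma para_frac p q : q != 0 -> para (tf p / tf q) = para_poly p / para_poly q.
Proof.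
move=> q0; rewrite /para; set r := repr _.
have d0 : \d_r != 0 by exact: denom_ratioP.
have := ratfun_repr (tf p / tf q); rewrite -/r => e.
have tq0 : tf q != 0 by rewrite tofrac_eq0.
have td0 : tf \d_r != 0 by rewrite tofrac_eq0.
have pq0 : para_poly q != 0 by rewrite para_poly_eq0.
have pd0 : para_poly \d_r != 0 by rewrite para_poly_eq0.
have /(congr1 (@para_poly C)) := eq_tofrac_div tq0 td0 e; rewrite !rmorphM /=.
by move=> e'; apply/eqP; rewrite (eqr_div _ _ pd0 pq0) e'.
Qed.

Lemma ratfunP f : exists p q, [/\ f = tf p / tf q, q != 0 & coprimep p q].
Proof.
have d0 : \d_(repr f) != 0 by exact: denom_ratioP.
have := ratfun_repr f; move: \n_ _ \d_ _ d0 => p q q0 ->.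
have g0 : gcdp p q != 0 by rewrite gcdp_eq0 (negPf q0) andbF.
exists (p %/ gcdp p q), (q %/ gcdp p q); split.
- have e1 : tf p = tf (p %/ gcdp p q) * tf (gcdp p q).
    by rewrite -rmorphM divpK ?dvdp_gcdl.
  have e2 : tf q = tf (q %/ gcdp p q) * tf (gcdp p q).
    by rewrite -rmorphM divpK ?dvdp_gcdr.
  rewrite {1}e1 {1}e2 -mulf_div divff ?mulr1 //.
  by rewrite tofrac_eq0.
- by apply: contra q0 => /eqP e; rewrite -(divpK (dvdp_gcdr p q)) e mul0r.
- by apply: coprimep_div_gcd; rewrite q0 orbT.
Qed.

Fact para_zmod : zmod_morphism (@para C).
Proof.
move=> f g; have [p [q [-> q0 _]]] := ratfunP f.
have [p' [q' [-> q'0 _]]] := ratfunP g.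
have tq0 : tf q != 0 by rewrite tofrac_eq0.
have tq'0 : tf q' != 0 by rewrite tofrac_eq0.
have pq0 : para_poly q != 0 by rewrite para_poly_eq0.
have pq'0 : para_poly q' != 0 by rewrite para_poly_eq0.
rewrite -[- (tf p' / tf q')]mulNr -(rmorphN tf) (tofrac_divD _ _ tq0 tq'0).
rewrite !para_frac ?mulf_neq0 //.
by rewrite -mulNr (addf_div _ _ pq0 pq'0) rmorphD !rmorphM /= rmorphN.
Qed.

Fact para_monoid : monoid_morphism (@para C).
Proof.
split=> [|f g].
  rewrite -[X in para X]divr1 -(rmorph1 tf) para_frac ?oner_neq0 //.
  by rewrite !rmorph1 divr1.
have [p [q [-> q0 _]]] := ratfunP f; have [p' [q' [-> q'0 _]]] := ratfunP g.
rewrite tofrac_divM !para_frac ?mulf_neq0 // mulf_div.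
by rewrite -!rmorphM.
Qed.
HB.instance Definition _ := GRing.isZmodMorphism.Build F F (@para C) para_zmod.
HB.instance Definition _ := GRing.isMonoidMorphism.Build F F (@para C) para_monoid.

Lemma para_rconst c : para (rconst c) = rconst c^*.
Proof.
rewrite -[X in para X]divr1 -(rmorph1 tf) para_frac ?oner_neq0 //.
by rewrite rmorph1 divr1 para_polyC.
Qed.

Lemma para_rvar : para (rvar C) = (rvar C)^-1.
Proof.
rewrite -[X in para X]divr1 -(rmorph1 tf) para_frac ?oner_neq0 //.
by rewrite rmorph1 divr1 para_polyX.
Qed.

Lemma has_value_para f z v : has_value f z v ->
  has_value (para f) (reflect_point z) v^*.
Proof.
case: z => [a|].
  move=> /has_value_finP[p [q [-> q0 ->]]].
  rewrite para_frac -?(tofrac_eq0 q) ?(horner_neq0 q0) // rmorphM fmorphV.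
  apply: has_valueM; first exact: has_value_para_poly.
  by apply: has_valueV; [exact: has_value_para_poly|rewrite conjC_eq0].
move=> /has_value_infP[p [q [n [-> sp sq q0 ->]]]].
have x0 : rvar C ^+ n != 0 by rewrite expf_neq0 ?rvar_neq0.
have -> : para (tf p / tf q)
    = (para_poly p * rvar C ^+ n) / (para_poly q * rvar C ^+ n).
  rewrite para_frac -?(tofrac_eq0 q) ?(coef_neq0 q0) //.
  by rewrite -mulf_div divff // mulr1.
rewrite rmorphM fmorphV; apply: has_valueM; first exact: has_value_para_poly_top.
by apply: has_valueV; [exact: has_value_para_poly_top|rewrite conjC_eq0].
Qed.

(** In lowest terms a root of the denominator is a pole, so f is a polynomial;
    analyticity at infinity bounds its degree by 0. *)
Lemma analytic_everywhere_const f :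
  (forall z, exists v, has_value f z v) -> exists c, f = rconst c.
Proof.
move=> fan; have [p [q [fE q0 copq]]] := ratfunP f.
have sq : size q = 1%N.
  apply/eqP; rewrite -[_ == _]negbK; apply/negP => /closed_rootP[a qa].
  have [v /has_value_finP[p' [q' [e q'a _]]]] := fan (Some a).
  move: e; rewrite fE => e.
  have tq0 : tf q != 0 by rewrite tofrac_eq0.
  have := eq_tofrac_div tq0 (horner_neq0 q'a) e.
  move/(congr1 (horner^~ a)); rewrite !hornerM (rootP qa) mulr0 => /eqP.
  rewrite mulf_eq0 (negPf q'a) orbF => pa.
  have := coprimep_root copq pa.
  by rewrite (rootP qa) eqxx.
have [c c0 qE] : exists2 c, c != 0 & q = c%:P by apply/size_poly1P; rewrite sq.
have [v /has_value_infP[p' [q' [n [e sp' sq' q'n _]]]]] := fan None.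
move: e; rewrite fE => e.
have tq0 : tf q != 0 by rewrite tofrac_eq0.
have e' := eq_tofrac_div tq0 (coef_neq0 q'n) e.
have q'0 : q' != 0 by apply: contra q'n => /eqP->; rewrite coef0.
have sq'E : (n < size q')%N.
  by rewrite ltnNge; apply: contra q'n => /leq_sizeP->.
have sp : (size p <= 1)%N.
  have [->|p0] := eqVneq p 0; first by rewrite size_poly0.
  have : (size (p * q')%R <= n.+1)%N.
    by rewrite e' qE mulrC mul_polyC (leq_trans (size_scale_leq _ _)).
  rewrite size_mul // -subn1 leq_subLR => s; rewrite -(leq_add2r n.+1).
  by apply: leq_trans s; rewrite leq_add2l.
exists (p`_0 / c); rewrite qE (size1_polyC sp) rmorphM fmorphV.
by rewrite coefC.
Qed.

(** On the circle f times [para f] is the square of a modulus, so the poles of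
    such terms cannot cancel in a sum.  If all x ^+ n.+1 * f j are analytic at a,
    where x = z - a, then the squared moduli of their values sum to the value of
    x ^+ n.+1 * para (x ^+ n.+1) times an analytic function, which is 0; so one
    factor x can be dropped. *)
Lemma analytic_of_sum_para k (f : 'I_k -> F) a : `|a| = 1 ->
  (exists v, has_value (\sum_j f j * para (f j)) (Some a) v) ->
  forall j, exists v, has_value (f j) (Some a) v.
Proof.
move=> a1 [s sv]; pose x := rvar C - rconst a.
have xv : has_value x (Some a) 0.
  by rewrite -(subrr a); apply: has_valueB (has_value_const _ _); apply: has_value_var.
have x0 : x != 0 by rewrite /x /rvar /rconst -rmorphB tofrac_eq0 polyXsubC_eq0.
have reflE := reflect_circle a1.
have [n fn] : exists n, forall j, exists v, has_value (x ^+ n * f j) (Some a) v.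
  have H j : exists n, exists v, has_value (x ^+ n * f j) (Some a) v.
    have [p [q [-> q0 _]]] := ratfunP (f j).
    have [n [r + qE]] := multiplicity_XsubC q a; rewrite q0 /= => ra.
    exists n, (p.[a] / r.[a]); apply/has_value_finP; exists p, r; split=> //.
    have rr0 : tf r != 0 := horner_neq0 ra.
    have -> : tf q = tf r * x ^+ n by rewrite qE rmorphM rmorphXn /x /= rmorphB.
    by rewrite mulrC invfM mulrA (mulfVK (expf_neq0 n x0)).
  have [N HN] := choice H; exists (\max_j N j) => j.
  have [v vP] := HN j; exists (0 ^+ (\max_j N j - N j) * v).
  rewrite -[X in x ^+ X](subnK (leq_bigmax j : N j <= \max_j N j)%N) exprD -mulrA.
  by apply: has_valueM _ vP; apply: has_valueX.
elim: n fn => [|n IHn] fn.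
  by move=> j; have [v] := fn j; rewrite expr0 mul1r; exists v.
apply: IHn; have [g gv] := choice fn.
have g0 : forall j, g j = 0.
  have sum0 : \sum_j g j * (g j)^* = 0.
    pose sq := \sum_j (x ^+ n.+1 * f j) * para (x ^+ n.+1 * f j).
    apply: (@has_value_uniq _ sq (Some a)).
      apply: has_value_sum => j; apply: has_valueM (gv j) _.
      by rewrite -reflE; apply: has_value_para.
    have -> : sq = x ^+ n.+1 * para (x ^+ n.+1) * (\sum_j f j * para (f j)).
      rewrite mulr_sumr; apply: eq_bigr => j _.
      by rewrite rmorphM mulrACA.
    rewrite -[X in has_value _ _ X](mul0r s); apply: has_valueM _ sv.
    rewrite -[X in has_value _ _ X](mul0r (0 ^+ n.+1)^*).
    apply: has_valueM; last by rewrite -reflE; apply/has_value_para/has_valueX.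
    by have := has_valueX n.+1 xv; rewrite expr0n.
  move=> j; apply/eqP; rewrite -normr_eq0 -sqrf_eq0 normCK.
  have ge0 i : true -> 0 <= g i * (g i)^* by rewrite mul_conjC_ge0.
  by rewrite (psumr_eq0P ge0 sum0).
move=> j; have := gv j; rewrite g0 => /has_value_div_root[v].
by rewrite -/x exprS -mulrA [x * _]mulrC (mulfK x0) => vP; exists v.
Qed.

End Para.

(** * Values of rational matrices *)

Section MxValues.
Variable C : numClosedFieldType.
Local Notation F := (ratfun C).
Local Notation cst := (map_mx (@rconst C)).
Implicit Types (f : F) (a v : C) (z : point C).

Lemma cstM m n l (A : 'M[C]_(m, n)) (B : 'M[C]_(n, l)) : cst (A *m B) = cst A *m cst B.
Proof. exact: map_mxM. Qed.

Lemma cstD m n (A B : 'M[C]_(m, n)) : cst (A + B) = cst A + cst B.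
Proof. exact: map_mxD. Qed.

Lemma cstN m n (A : 'M[C]_(m, n)) : cst (- A) = - cst A.
Proof. exact: map_mxN. Qed.

Lemma cst1 n : cst 1%:M = 1%:M :> 'M[F]_n.
Proof. exact: map_mx1. Qed.

Lemma cst0 m n : cst 0 = 0 :> 'M[F]_(m, n).
Proof. exact: map_mx0. Qed.

Lemma cst_inj m n : injective (fun A : 'M[C]_(m, n) => cst A).
Proof.
move=> A B /matrixP AB; apply/matrixP => i j.
by have := AB i j; rewrite !mxE => /(fmorph_inj (@rconst C)).
Qed.

Lemma mx_value_cst m n (A : 'M[C]_(m, n)) z : mx_value (cst A) z A.
Proof. by move=> i j; rewrite mxE; apply: has_value_const. Qed.

Lemma mx_value0 m n z : mx_value (0 : 'M[F]_(m, n)) z 0.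
Proof. by move=> i j; rewrite !mxE; apply: has_value0. Qed.

Lemma mx_value_scalar n f z v : has_value f z v ->
  mx_value (f%:M : 'M[F]_n) z v%:M.
Proof.
move=> fv i j; rewrite !mxE; case: (i == j); first by rewrite !mulr1n.
by rewrite !mulr0n; apply: has_value0.
Qed.

Lemma mx_value1 n z : mx_value (1%:M : 'M[F]_n) z 1%:M.
Proof. exact: mx_value_scalar (has_value1 _). Qed.

Section Operations.
Variables (m n : nat) (z : point C).
Implicit Types (W : 'M[F]_(m, n)) (V : 'M[C]_(m, n)).

Lemma mx_valueD W W' V V' : mx_value W z V -> mx_value W' z V' ->
  mx_value (W + W') z (V + V').
Proof. by move=> WV WV' i j; rewrite !mxE; apply: has_valueD. Qed.

Lemma mx_valueN W V : mx_value W z V -> mx_value (- W) z (- V).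
Proof. by move=> WV i j; rewrite !mxE; apply: has_valueN. Qed.

Lemma mx_valueB W W' V V' : mx_value W z V -> mx_value W' z V' ->
  mx_value (W - W') z (V - V').
Proof. by move=> WV WV'; apply/mx_valueD/mx_valueN. Qed.

Lemma mx_valueZ f v W V : has_value f z v -> mx_value W z V ->
  mx_value (f *: W) z (v *: V).
Proof. by move=> fv WV i j; rewrite !mxE; apply: has_valueM. Qed.

Lemma mx_valueM l W V (W' : 'M[F]_(n, l)) (V' : 'M[C]_(n, l)) :
  mx_value W z V -> mx_value W' z V' -> mx_value (W *m W') z (V *m V').
Proof.
by move=> WV WV' i j; rewrite !mxE; apply: has_value_sum => k; apply: has_valueM.
Qed.

Lemma mx_value_tr W V : mx_value W z V -> mx_value W^T z V^T.
Proof. by move=> WV i j; rewrite !mxE. Qed.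

Lemma mx_value_para W V : mx_value W z V ->
  mx_value (paramx W) (reflect_point z) (V^t*).
Proof. by move=> WV i j; rewrite !mxE; apply: has_value_para. Qed.

Lemma mx_value_uniq W V V' : mx_value W z V -> mx_value W z V' -> V = V'.
Proof.
by move=> WV WV'; apply/matrixP => i j; apply: has_value_uniq (WV i j) (WV' i j).
Qed.

Lemma analytic_mx W : (forall i j, exists v, has_value (W i j) z v) ->
  exists V, mx_value W z V.
Proof.
move=> h; have [g gP] := choice (fun ij : 'I_m * 'I_n => h ij.1 ij.2).
by exists (\matrix_(i, j) g (i, j)) => i j; rewrite mxE; apply: (gP (i, j)).
Qed.

Lemma mx_value_col l W V (W' : 'M[F]_(l, n)) (V' : 'M[C]_(l, n)) :
  mx_value W z V -> mx_value W' z V' -> mx_value (col_mx W W') z (col_mx V V').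
Proof. by move=> WV WV' i j; rewrite !mxE; case: (split i) => k. Qed.

End Operations.

Lemma mx_value_det n z (W : 'M[F]_n) V :
  mx_value W z V -> has_value (\det W) z (\det V).
Proof.
move=> WV; apply: has_value_sum => s; apply: has_valueM; last first.
  by apply: has_value_prod => i; apply: WV.
by apply/has_valueX/has_valueN/has_value1.
Qed.

Lemma mx_value_unit n z (W : 'M[F]_n) V :
  mx_value W z V -> V \in unitmx -> W \in unitmx.
Proof.
by move=> /mx_value_det WV; rewrite !unitmxE !unitfE; apply: has_value_neq0 WV.
Qed.

Lemma mx_value_inv n z (W : 'M[F]_n) V :
  mx_value W z V -> V \in unitmx -> mx_value (invmx W) z (invmx V).
Proof.
move=> WV Vu; rewrite /invmx Vu (mx_value_unit WV Vu).
apply: mx_valueZ => [|i j].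
  by apply: has_valueV (mx_value_det WV) _; rewrite -unitfE -unitmxE.
rewrite !mxE; apply: has_valueM; last first.
  by apply: mx_value_det => k l; rewrite !mxE; apply: WV.
by apply/has_valueX/has_valueN/has_value1.
Qed.

Lemma row_full_inj m n (V : 'M[C]_(m, n)) :
  (forall v : 'cV_n, V *m v = 0 -> v = 0) -> row_full V.
Proof.
move=> inj; rewrite /row_full -mxrank_tr -[_ == _]/(row_free V^T) -kermx_eq0.
apply/eqP/row_matrixP => i; rewrite row0; apply: trmx_inj; rewrite trmx0.
by apply: inj; apply: trmx_inj; rewrite trmx_mul trmxK -row_mul mulmx_ker row0 trmx0.
Qed.

(** A constant left inverse L of V makes L W invertible near the point, so that
    Y = (L W)^-1 L (W Y). *)
Lemma mx_value_cancel m n l z (W : 'M[F]_(m, n)) V (Y : 'M[F]_(n, l)) U :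
  mx_value W z V -> row_full V -> mx_value (W *m Y) z U ->
  exists VY, mx_value Y z VY.
Proof.
move=> WV /row_fullP[L LV] WYU.
have LW : mx_value (cst L *m W) z 1%:M.
  by rewrite -LV; apply: mx_valueM WV; apply: mx_value_cst.
have LWu := mx_value_unit LW (unitmx1 _ _).
rewrite -[Y](mulKmx LWu); eexists; apply: mx_valueM.
  by apply: mx_value_inv LW (unitmx1 _ _).
by rewrite -mulmxA; apply: mx_valueM WYU; apply: mx_value_cst.
Qed.

Lemma analytic_everywhere_cst m n (W : 'M[F]_(m, n)) :
  (forall z, exists V, mx_value W z V) -> exists A, W = cst A.
Proof.
move=> Wan.
have h (ij : 'I_m * 'I_n) : exists c, W ij.1 ij.2 = rconst c.
  apply: analytic_everywhere_const => z.
  by have [V /(_ ij.1 ij.2)] := Wan z; exists (V ij.1 ij.2).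
have [g gP] := choice h.
by exists (\matrix_(i, j) g (i, j)); apply/matrixP => i j; rewrite !mxE (gP (i, j)).
Qed.

Lemma paramxM m n l (A : 'M[F]_(m, n)) (B : 'M[F]_(n, l)) :
  paramx (A *m B) = paramx B *m paramx A.
Proof. by rewrite /paramx trmx_mul map_mxM. Qed.

Lemma paramx1 n : paramx (1%:M : 'M[F]_n) = 1%:M.
Proof. by rewrite /paramx trmx1 map_mx1. Qed.

Lemma paramxD m n (A B : 'M[F]_(m, n)) : paramx (A + B) = paramx A + paramx B.
Proof. by apply/matrixP => i j; rewrite !mxE rmorphD. Qed.

Lemma paramxN m n (A : 'M[F]_(m, n)) : paramx (- A) = - paramx A.
Proof. by apply/matrixP => i j; rewrite !mxE rmorphN. Qed.

Lemma paramxZ m n f (A : 'M[F]_(m, n)) : paramx (f *: A) = para f *: paramx A.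
Proof. by apply/matrixP => i j; rewrite !mxE rmorphM. Qed.

Lemma paramx_scalar n f : paramx (f%:M : 'M[F]_n) = (para f)%:M.
Proof. by rewrite /paramx tr_scalar_mx map_scalar_mx. Qed.

Lemma paramxV n (A : 'M[F]_n) : paramx (invmx A) = invmx (paramx A).
Proof. by rewrite /paramx trmx_inv map_invmx. Qed.

Lemma paramx_cst m n (A : 'M[C]_(m, n)) : paramx (cst A) = cst (A^t*).
Proof. by apply/matrixP => i j; rewrite !mxE para_rconst. Qed.

Lemma paramx_col m n l (A : 'M[F]_(m, n)) (B : 'M[F]_(l, n)) :
  paramx (col_mx A B) = row_mx (paramx A) (paramx B).
Proof. by rewrite /paramx tr_col_mx map_row_mx. Qed.

(** The diagonal entries of W W~ are sums as in [analytic_of_sum_para]. *)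
Lemma analytic_on_circle m n (W : 'M[F]_(m, n)) (Phi : 'M[F]_m) V a :
  Phi = W *m paramx W -> `|a| = 1 -> mx_value Phi (Some a) V ->
  exists U, mx_value W (Some a) U.
Proof.
move=> PhiE a1 PV; apply: analytic_mx => i.
apply: analytic_of_sum_para a1 _; exists (V i i); have := PV i i.
by rewrite PhiE mxE; under eq_bigr do rewrite !mxE.
Qed.

End MxValues.

(** * The Stein equation *)

Section Stein.
Variable C : numClosedFieldType.
Implicit Types (a : C).

Lemma ctrmxM m n l (A : 'M[C]_(m, n)) (B : 'M[C]_(n, l)) :
  (A *m B)^t* = B^t* *m A^t*.
Proof. by rewrite trmx_mul map_mxM. Qed.

Lemma ctrmxD m n (A B : 'M[C]_(m, n)) : (A + B)^t* = A^t* + B^t*.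
Proof. by rewrite linearD map_mxD. Qed.

Lemma ctrmxN m n (A : 'M[C]_(m, n)) : (- A)^t* = - A^t*.
Proof. by rewrite linearN map_mxN. Qed.

Lemma ctrmxZ m n a (A : 'M[C]_(m, n)) : (a *: A)^t* = a^* *: A^t*.
Proof. by rewrite linearZ map_mxZ. Qed.

Lemma ctrmx0 m n : (0 : 'M[C]_(m, n))^t* = 0.
Proof. by rewrite trmx0 map_mx0. Qed.

Lemma ctrmx1 n : (1%:M : 'M[C]_n)^t* = 1%:M.
Proof. by rewrite trmx1 map_mx1. Qed.

Lemma ctrmx_unit n (A : 'M[C]_n) : (A^t* \in unitmx) = (A \in unitmx).
Proof. by rewrite map_unitmx unitmx_tr. Qed.

Lemma ctrmx_inv n (A : 'M[C]_n) : (invmx A)^t* = invmx (A^t*).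
Proof. by rewrite trmx_inv map_invmx. Qed.

Lemma eigenvalue_unitmx n (A : 'M[C]_n) a :
  eigenvalue A a = (A - a%:M \notin unitmx).
Proof. by rewrite -row_free_unit -kermx_eq0. Qed.

Lemma eigenvalue_tr n (A : 'M[C]_n) a : eigenvalue A^T a = eigenvalue A a.
Proof.
by rewrite !eigenvalue_unitmx -[in RHS]unitmx_tr linearB /= tr_scalar_mx.
Qed.

Lemma eigenvalue_ctr n (A : 'M[C]_n) a : eigenvalue (A^t*) a^* = eigenvalue A a.
Proof. by rewrite (eigenvalue_map Num.conj) eigenvalue_tr. Qed.

Lemma eigenvalue_colP n (A : 'M[C]_n) a :
  reflect (exists2 v : 'cV_n, A *m v = a *: v & v != 0) (eigenvalue A a).
Proof.
rewrite -eigenvalue_tr; apply: (iffP eigenvalueP) => -[v Av v0].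
  exists v^T; last by apply: contra v0; rewrite -trmx_eq0 trmxK.
  by apply: trmx_inj; rewrite trmx_mul linearZ /= !trmxK.
exists v^T; last by apply: contra v0; rewrite -trmx_eq0 trmxK.
by rewrite -trmx_mul Av linearZ.
Qed.

(** This is the property of the block [Au]: its eigenvalues are unstable poles. *)
Definition antistable n (A : 'M[C]_n) := forall a, eigenvalue A a -> 1 < `|a|.

Lemma antistable_unit n (A : 'M[C]_n) : antistable A -> A \in unitmx.
Proof.
move=> Aas; apply: contraT => Anu; have /Aas : eigenvalue A 0.
  by rewrite eigenvalue_unitmx raddf0 subr0.
by rewrite normr0 ltr10.
Qed.

Lemma antistable_subr1 n (A : 'M[C]_n) a : antistable A -> `|a| <= 1 ->
  a%:M - A \in unitmx.
Proof.
move=> Aas a1; apply: contraT => nu; have /Aas : eigenvalue A a.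
  by rewrite eigenvalue_unitmx -opprB -scaleN1r unitmxZ ?unitrN1.
by move=> /lt_geF; rewrite a1.
Qed.

(** X intertwines A^-1 and the conjugate transpose of A.  With X = L R a full rank
    factorization, both act through one and the same matrix B of size rank X.  An
    eigenvalue of B is then the conjugate of an eigenvalue of A, of modulus above
    1, and the inverse of one, of modulus below 1. *)
Lemma stein_homogeneous n (A X : 'M[C]_n) : antistable A ->
  X = A^t* *m X *m A -> X = 0.
Proof.
move=> Aas XE; have Au := antistable_unit Aas.
apply/eqP; rewrite -mxrank_eq0 -leqn0 leqNgt; apply/negP => r0.
have XAE : X *m invmx A = A^t* *m X by rewrite {1}XE mulmxK.
have /submxP[B RA] : (row_base X *m invmx A <= row_base X)%MS.
  apply: submx_trans (_ : X *m invmx A <= _)%MS.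
    by rewrite submxMr // eq_row_base.
  by rewrite XAE eq_row_base submxMl.
have ALB : A^t* *m col_base X = col_base X *m B.
  apply: (row_free_inj (row_base_free X)).
  by rewrite /= -[LHS]mulmxA mulmx_base -[RHS]mulmxA -RA mulmxA mulmx_base XAE.
have [mu mu_eig] := eigenvalue_closed B r0.
have [w wB w0] := eigenvalueP mu_eig; have [u Bu u0] := eigenvalue_colP _ _ mu_eig.
have mu1 : 1 < `|mu|.
  rewrite -norm_conjC; apply: Aas; rewrite -eigenvalue_ctr conjCK.
  apply/eigenvalue_colP; exists (col_base X *m u).
    by rewrite mulmxA ALB -mulmxA Bu scalemxAr.
  apply: contra u0 => /eqP e.
  have /row_fullP[L LX] := col_base_full X.
  by rewrite -[u]mul1mx -LX -mulmxA e mulmx0.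
have mu0 : mu != 0 by rewrite -normr_gt0 (lt_trans ltr01).
suff /Aas : eigenvalue A mu^-1.
  by rewrite normfV invf_gt1 ?normr_gt0 // => /(lt_trans mu1); rewrite ltxx.
apply/eigenvalueP; exists (w *m row_base X).
  have := congr1 (fun Z => mu^-1 *: (w *m Z *m A)) RA.
  by rewrite !mulmxA mulmxKV // wB -!scalemxAl scalerA mulVf // scale1r.
by rewrite mulmx_free_eq0 // row_base_free.
Qed.

Lemma stein_exists n (A Q : 'M[C]_n) : antistable A ->
  exists X, X - A^t* *m X *m A = Q.
Proof.
move=> Aas; pose L := 1%:M - lin_mulmx (A^t*) *m lin_mulmxr A : 'M[C]_(n * n).
have LE X : mxvec X *m L = mxvec (X - A^t* *m X *m A).
  by rewrite mulmxBr mulmx1 mulmxA !mul_vec_lin linearB.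
have Lu : L \in unitmx.
  rewrite -row_free_unit -kermx_eq0; apply/eqP/row_matrixP => i; rewrite row0.
  have := congr1 (row i) (mulmx_ker L); rewrite row_mul row0.
  move: (row i _) => w; rewrite -[w]vec_mxK LE => /(congr1 vec_mx).
  rewrite mxvecK raddf0 => /eqP; rewrite subr_eq0 => /eqP /(stein_homogeneous Aas) ->.
  by rewrite raddf0.
exists (vec_mx (mxvec Q *m invmx L)); apply: (can_inj mxvecK).
by rewrite -LE vec_mxK mulmxKV.
Qed.

Lemma stein_unique n (A Q X Y : 'M[C]_n) : antistable A ->
  X - A^t* *m X *m A = Q -> Y - A^t* *m Y *m A = Q -> X = Y.
Proof.
move=> Aas XQ YQ; apply/eqP; rewrite -subr_eq0; apply/eqP.
apply: (stein_homogeneous Aas); apply/eqP; rewrite -subr_eq0; apply/eqP.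
transitivity ((X - A^t* *m X *m A) - (Y - A^t* *m Y *m A)); last first.
  by rewrite XQ YQ subrr.
by rewrite mulmxBr mulmxBl !opprB addrACA [RHS]addrACA [- Y + _]addrC.
Qed.

Lemma stein_hermitian n (A Q X : 'M[C]_n) : antistable A -> Q^t* = Q ->
  X - A^t* *m X *m A = Q -> X^t* = X.
Proof.
move=> Aas QQ XQ; apply: (stein_unique Aas _ XQ).
by rewrite -[RHS]QQ -XQ ctrmxD ctrmxN !ctrmxM trmxCK mulmxA.
Qed.

End Stein.

Section SteinUnit.
Variable C : numClosedFieldType.

(** The eigenvector form of observability (Popov, Belevitch, Hautus). *)
Definition observable n l (A : 'M[C]_n) (Cm : 'M[C]_(l, n)) :=
  forall (v : 'cV_n) a, A *m v = a *: v -> Cm *m v = 0 -> v = 0.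

Lemma ctr_mul_ge0 l (v : 'cV[C]_l) : 0 <= (v^t* *m v) 0 0.
Proof. by rewrite mxE sumr_ge0 // => i _; rewrite !mxE mulrC mul_conjC_ge0. Qed.

Lemma ctr_mul_eq0 l (v : 'cV[C]_l) : (v^t* *m v) 0 0 = 0 -> v = 0.
Proof.
rewrite mxE => s0; apply/matrixP => i j; rewrite ord1 mxE; apply/eqP.
rewrite -normr_eq0 -sqrf_eq0 normCK mulrC.
have ge0 k : true -> 0 <= v^t* 0 k * v k 0 by rewrite !mxE mulrC mul_conjC_ge0.
by move: s0 => /(psumr_eq0P ge0)/(_ i); rewrite !mxE => ->.
Qed.

Lemma kernel_basis n (v : 'cV[C]_n) : v != 0 ->
  exists r (L : 'M[C]_(r, n)), [/\ (r < n)%N, row_free L, L *m v = 0 &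
    forall p (Y : 'M_(p, n)), Y *m v = 0 -> exists Z, Y = Z *m L].
Proof.
move=> v0; exists (\rank (kermx v)), (row_base (kermx v)); split.
- rewrite mxrank_ker -subn_gt0 subKn ?rank_leq_row //.
  by rewrite lt0n mxrank_eq0.
- exact: row_base_free.
- by apply/sub_kermxP; rewrite eq_row_base.
move=> p Y /sub_kermxP; rewrite -(eq_row_base (kermx _)) => /submxP[Z ->].
by exists Z.
Qed.

Lemma kernel_basis_col n (x : 'rV[C]_n) : x != 0 ->
  exists r (E : 'M[C]_(n, r)), [/\ (r < n)%N, row_free E^T, x *m E = 0 &
    forall p (Y : 'M_(n, p)), x *m Y = 0 -> exists Z, Y = E *m Z].
Proof.
rewrite -trmx_eq0 => /kernel_basis[r [L [r_lt Lfree Lx Lspan]]].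
exists r, L^T; split=> //; first by rewrite trmxK.
  by apply: trmx_inj; rewrite trmx_mul trmxK Lx trmx0.
move=> p Y /(congr1 trmx); rewrite trmx_mul trmx0 => /Lspan[Z YZ].
by exists Z^T; apply: trmx_inj; rewrite trmx_mul !trmxK.
Qed.

Lemma scalar_mx1_inj (x y : C) : x%:M = y%:M :> 'M_1 -> x = y.
Proof. by move/matrixP/(_ 0 0); rewrite !mxE !mulr1n. Qed.

(** Induction on the size.  Let v be an eigenvector of A and let E span the
    complement of v for the form X, so that A E = v b + E A1.  Then E^* X E solves
    a Stein equation for A1, whose right-hand side is again of the form C1^* C1
    with (A1, C1) observable, and the kernel of X lies in the span of E because
    v^* X v is not 0. *)
Lemma stein_unit n l (A X : 'M[C]_n) (Cm : 'M[C]_(l, n)) :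
  antistable A -> observable A Cm -> X^t* = X ->
  X = A^t* *m X *m A + Cm^t* *m Cm -> X \in unitmx.
Proof.
move=> Aas obs XX XE.
suff kerX : forall w : 'cV_n, X *m w = 0 -> w = 0.
  by rewrite -row_full_unit; apply: row_full_inj.
have [k] := ubnP n; elim: k => // k IHk in n A X Cm Aas obs XX XE *.
rewrite ltnS => le_nk w Xw0.
have [n0|n_gt0] := posnP n; first by subst n; rewrite (flatmx0 w).
have [a a_eig] := eigenvalue_closed A n_gt0.
have [v Av v0] := eigenvalue_colP _ _ a_eig; have a1 := Aas _ a_eig.
(* The matrices c1, c2, d and y below are opaque names, so that rewriting with
   associativity does not look into them. *)
pose t := `|a|^-1; have [c1 c1E] : exists c1, c1 = Cm *m v by exists (Cm *m v).
pose s := (c1^t* *m c1) 0 0.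
have na0 : 0 < `|a| := lt_trans ltr01 a1.
have a0 : a != 0 by rewrite -normr_gt0.
have t0 : t != 0 by rewrite invr_eq0 gt_eqF.
have s0 : s != 0.
  apply: contra v0 => /eqP/ctr_mul_eq0 c10; apply/eqP.
  by apply: obs Av _; rewrite -c1E.
pose x := (v^t* *m X *m v) 0 0.
have vXv : v^t* *m X *m v = x%:M by apply: mx11_scalar.
have c1c1 : c1^t* *m c1 = s%:M by apply: mx11_scalar.
have vA : v^t* *m A^t* = a^* *: v^t* by rewrite -ctrmxM Av ctrmxZ.
have xE : x = a^* * a * x + s.
  apply: scalar_mx1_inj; rewrite raddfD /= -vXv {1}XE mulmxDr mulmxDl.
  congr (_ + _); last by rewrite -c1c1 c1E ctrmxM !mulmxA.
  rewrite !mulmxA vA -!scalemxAl -[_ *m A *m v]mulmxA Av -scalemxAr vXv scalerA.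
  by rewrite scale_scalar_mx.
have x0 : x != 0 by apply: contra s0 => /eqP x0; move: xE; rewrite x0 mulr0 add0r => <-.
have vX0 : v^t* *m X != 0.
  apply: contra x0 => /eqP e; move: vXv; rewrite e mul0mx => /esym/eqP.
  by rewrite -scalemx1 scalemx_eq0 oner_eq0 orbF.
have [r [E [r_lt Efree EO Espan]]] := kernel_basis_col vX0.
have Einj p (u : 'M_(r, p)) : E *m u = 0 -> u = 0.
  move/(congr1 trmx); rewrite trmx_mul trmx0 => /eqP.
  rewrite mulmx_free_eq0 // => /eqP u0.
  by apply: trmx_inj; rewrite u0 trmx0.
have [c2 c2E] : exists c2, c2 = Cm *m E by exists (Cm *m E).
have [b vXAE] : exists b, v^t* *m X *m (A *m E) = x *: b.
  by exists (x^-1 *: (v^t* *m X *m (A *m E))); rewrite scalerA divff // scale1r.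
have [A1 AE] : exists A1, A *m E = v *m b + E *m A1.
  have [|A1 eA1] := Espan _ (A *m E - v *m b).
    by rewrite mulmxBr vXAE mulmxA vXv mul_scalar_mx subrr.
  by exists A1; rewrite -eA1 addrC subrK.
have [d dE] : exists d, d = c1^t* *m c2 by exists (c1^t* *m c2).
have bE : b = - (a^* * x)^-1 *: d.
  have : (a^* * x) *: b = - d.
    apply/eqP; rewrite -addr_eq0; apply/eqP.
    rewrite -EO [in RHS]XE mulmxDr mulmxDl.
    rewrite !mulmxA vA -!scalemxAl -[_ *m A *m E]mulmxA vXAE scalerA.
    by rewrite dE c1E c2E ctrmxM !mulmxA.
  move=> e; rewrite scaleNr -scalerN -e scalerA mulVf ?scale1r //.
  by rewrite mulf_neq0 ?conjC_eq0.
have nt : a^* * a = t^-2.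
  by rewrite /t exprVn invrK mulrC -normCK.
have tr : t^* = t by apply: CrealP; rewrite rpredV normr_real.
have sr : s^* = s.
  by rewrite geC0_conj // ctr_mul_ge0.
have xr : x^* = x.
  have : (v^t* *m X *m v)^t* = v^t* *m X *m v by rewrite !ctrmxM trmxCK XX mulmxA.
  by rewrite vXv => /matrixP/(_ 0 0); rewrite !mxE !mulr1n.
(* The right-hand side for A1 is c2^* J c2, where J = I - k c1 c1^* and
   k s = 1 - t ^+ 2; with this del the matrix I - del c1 c1^* squares to J. *)
pose del := (1 - t) / s.
have delr : del^* = del by rewrite rmorphM fmorphV rmorphB rmorph1 /= tr sr.
pose C1 := c2 - del *: (c1 *m d).
have EXv : E^t* *m X *m v = 0.
  have := congr1 (fun Z : 'M_(1, r) => Z^t*) EO.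
  by rewrite !ctrmxM XX trmxCK mulmxA ctrmx0.
suff X1u : forall u : 'cV_r, (E^t* *m X *m E) *m u = 0 -> u = 0.
  have [|u wE] := Espan _ w; first by rewrite -mulmxA Xw0 mulmx0.
  by rewrite wE (X1u u) ?mulmx0 // -mulmxA -wE -mulmxA Xw0 mulmx0.
apply: (IHk r A1 _ C1); last exact: leq_trans r_lt le_nk.
(* An eigenvalue of A1 other than a is one of A: correct E u by a multiple of v. *)
- move=> la /eigenvalue_colP[u Au u0].
  have [-> //|la_a] := eqVneq la a.
  have la_a0 : la - a != 0 by rewrite subr_eq0.
  apply: Aas; pose y := (b *m u) 0 0.
  have yE : b *m u = y%:M by apply: mx11_scalar.
  apply/eigenvalue_colP; exists (E *m u + (y / (la - a)) *: v).
    rewrite mulmxDr mulmxA AE mulmxDl -!mulmxA Au yE -!scalemxAr Av.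
    rewrite mul_mx_scalar scalerDr addrAC addrC; congr (_ + _).
    by rewrite !scalerA -scalerDl; congr (_ *: _); field.
  apply: contra u0 => /eqP e.
  have := congr1 (fun Z => v^t* *m X *m Z) e; rewrite /= mulmxDr mulmxA EO mul0mx add0r.
  rewrite mulmx0 -scalemxAr vXv => /eqP.
  rewrite scalemx_eq0 -scalemx1 scalemx_eq0 oner_eq0 (negPf x0) !orbF => /eqP y0.
  by move: e; rewrite y0 scale0r addr0 => /Einj->.
(* The factor I - del c1 c1^* is injective, so C1 u = 0 forces c2 u = 0, then
   b u = 0, and E u is an unobservable eigenvector of A. *)
- move=> u la Au C1u.
  have [y yE0] : exists y, y = c2 *m u by exists (c2 *m u).
  pose h := (c1^t* *m y) 0 0.
  have hE : c1^t* *m y = h%:M by apply: mx11_scalar.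
  have yE : y = (del * h) *: c1.
    apply/eqP; rewrite -subr_eq0 -[X in _ == X]C1u mulmxBl -scalemxAl -yE0 -scalerA.
    by rewrite -!mulmxA dE -mulmxA -yE0 hE mul_mx_scalar.
  have h0 : h = 0.
    have : h%:M = (del * h * s)%:M :> 'M_1.
      by rewrite -hE {1}yE -scalemxAr c1c1 scale_scalar_mx.
    move/scalar_mx1_inj => e; apply/eqP.
    have : t * h = 0.
      have -> : t * h = h - del * h * s by rewrite /del; field.
      by rewrite -e subrr.
    by move/eqP; rewrite mulf_eq0 (negPf t0).
  have y0 : y = 0 by rewrite yE h0 mulr0 scale0r.
  apply: Einj; apply: (obs _ la).
    rewrite mulmxA AE mulmxDl -!mulmxA Au bE -scalemxAl dE -!mulmxA -yE0 y0 !mulmx0.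
    by rewrite scaler0 mulmx0 add0r -scalemxAr.
  by rewrite mulmxA -c2E -yE0.
- by rewrite !ctrmxM XX trmxCK mulmxA.
have dCM : C1^t* *m C1 = c2^t* *m c2 + x *: (b^t* *m b).
  have c1c2 : c2^t* *m c1 = d^t* by rewrite dE ctrmxM trmxCK.
  rewrite /C1 ctrmxD ctrmxN ctrmxZ delr ctrmxM mulmxBl !mulmxBr.
  rewrite -!scalemxAl -!scalemxAr !mulmxA c1c2 -[d^t* *m c1^t* *m c1]mulmxA c1c1.
  rewrite mul_mx_scalar -[d^t* *m c1^t* *m c2]mulmxA -dE -scalemxAl bE ctrmxZ.
  rewrite -scalemxAl -scalemxAr !scalerA.
  rewrite opprB -addrA; congr (_ + _); rewrite -!scaleNr -!scalerDl; congr (_ *: _).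
  rewrite rmorphN fmorphV rmorphM /= conjCK xr.
  have sE : s = x * (1 - a^* * a) by rewrite mulrBr mulr1 {1}xE; ring.
  have xV : x^-1 = (1 - a^* * a) / s.
    by apply: (mulfI x0); rewrite divff // mulrA -sE divff.
  have ac0 : a^* != 0 by rewrite conjC_eq0.
  have -> : x * - (a * x)^-1 * - (a^* * x)^-1 = (a^* * a)^-1 * x^-1.
    by field; rewrite ac0 a0 x0.
  by rewrite xV nt invrK /del; field; rewrite s0 t0.
rewrite dCM.
have EXE : E^t* *m X *m E = (A *m E)^t* *m X *m (A *m E) + c2^t* *m c2.
  by rewrite [in LHS]XE c2E !ctrmxM mulmxDr mulmxDl !mulmxA.
have h1 : b^t* *m v^t* *m X *m v *m b = x *: (b^t* *m b).
  rewrite -[b^t* *m v^t* *m X]mulmxA -[b^t* *m _ *m v]mulmxA vXv mul_mx_scalar.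
  by rewrite -scalemxAl.
have h2 : b^t* *m v^t* *m X *m E *m A1 = 0.
  by rewrite -[b^t* *m v^t* *m X]mulmxA -[b^t* *m _ *m E]mulmxA EO mulmx0 mul0mx.
have h3 : A1^t* *m E^t* *m X *m v *m b = 0.
  by rewrite -[_ *m E^t* *m X]mulmxA -[A1^t* *m _ *m v]mulmxA EXv mulmx0 mul0mx.
rewrite [LHS]EXE AE ctrmxD !ctrmxM !mulmxDl !mulmxDr !mulmxA h1 h2 h3 addr0 add0r.
by rewrite [x *: _ + _]addrC -addrA [x *: _ + _]addrC.
Qed.

End SteinUnit.

(** * Realizations and feedback *)

(** Here R0 and R' stand for the resolvents of the open and of the closed loop.
    The identities are stated over a general field to keep rewriting away from
    the representation of rational functions. *)
Section Feedback.
Variable K : fieldType.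
Variables (n l : nat) (R' R0 : 'M[K]_n) (Cm : 'M[K]_(l, n)) (N : 'M[K]_(n, l)).
Hypothesis RE : R' = R0 + R' *m N *m Cm *m R0.

Lemma feedback_algebra k r (B : 'M_(n, k)) (D : 'M_(l, k)) (P : 'M_(r, l)) :
  P *m Cm *m R' *m (B + N *m D) + P *m D =
  (P *m Cm *m R' *m N + P) *m (Cm *m R0 *m B + D).
Proof.
have e : P *m Cm *m R' *m B =
    P *m Cm *m R' *m N *m (Cm *m R0 *m B) + P *m (Cm *m R0 *m B).
  by rewrite {1}RE mulmxDr mulmxDl !mulmxA addrC.
rewrite mulmxDr e mulmxDl !mulmxDr !mulmxA.
by rewrite addrA; congr (_ + _); apply: addrAC.
Qed.

Lemma feedback_inverse_algebra :
  (Cm *m R' *m N + 1%:M) *m (Cm *m R0 *m (- N) + 1%:M) = 1%:M.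
Proof.
have e : Cm *m R' *m N = Cm *m R0 *m N + Cm *m R' *m N *m (Cm *m R0 *m N).
  by rewrite {1}RE mulmxDr mulmxDl !mulmxA.
rewrite mulmxDl mulmxDr mulmx1 mul1mx !mulmxN addrA {2}e.
by rewrite [_ + (_ + _)]addrC addrK subrr add0r.
Qed.

End Feedback.

Section Realizations.
Variable C : numClosedFieldType.
Local Notation F := (ratfun C).
Local Notation cst := (map_mx (@rconst C)).
Local Notation z := (rvar C).

Lemma mx_value_resolvent n (A : 'M[C]_n) a : a%:M - A \in unitmx ->
  mx_value (invmx (z%:M - cst A)) (Some a) (invmx (a%:M - A)).
Proof.
move=> u; apply: mx_value_inv u; apply: mx_valueB; last exact: mx_value_cst.
by apply: mx_value_scalar; apply: has_value_var.
Qed.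

Lemma mx_value_resolvent_scaled_inf n (A : 'M[C]_n) :
  mx_value (z^-1 *: (z%:M - cst A)) None 1%:M.
Proof.
rewrite scalerBr scale_scalar_mx mulVf ?rvar_neq0 //.
rewrite -[X in mx_value _ _ X]subr0; apply: mx_valueB; first exact: mx_value1.
rewrite -[X in mx_value _ _ X](scale0r A).
by apply: mx_valueZ (has_value_varV C) (mx_value_cst _ _).
Qed.

Lemma resolvent_unit n (A : 'M[C]_n) : z%:M - cst A \in unitmx.
Proof.
have := mx_value_unit (mx_value_resolvent_scaled_inf A) (unitmx1 _ _).
by rewrite unitmxZ // unitfE invr_eq0 rvar_neq0.
Qed.

Lemma mx_value_scaled_resolvent_inf n (A : 'M[C]_n) :
  mx_value (z *: invmx (z%:M - cst A)) None 1%:M.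
Proof.
have := mx_value_inv (mx_value_resolvent_scaled_inf A) (unitmx1 _ _).
by rewrite invmx1 invmxZ ?invrK // unitmxZ ?resolvent_unit // unitfE invr_eq0 rvar_neq0.
Qed.

Lemma mx_value_resolvent_inf n (A : 'M[C]_n) :
  mx_value (invmx (z%:M - cst A)) None 0.
Proof.
rewrite -[invmx _]scale1r -(mulVf (rvar_neq0 C)) -scalerA -(scale0r 1%:M).
by apply: mx_valueZ (has_value_varV C) (mx_value_scaled_resolvent_inf A).
Qed.

Lemma realizes_proper n k l (T : 'M[F]_(l, k)) (A : 'M[C]_n) B Cm D :
  realizes T A B Cm D -> mx_value T None D.
Proof.
move=> ->; rewrite -[D in mx_value _ _ D]add0r -(mul0mx _ B) -(mulmx0 _ Cm).
apply: mx_valueD; last exact: mx_value_cst.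
apply: mx_valueM (mx_value_cst _ _); apply: mx_valueM; first exact: mx_value_cst.
exact: mx_value_resolvent_inf.
Qed.

(** The dual eigenvector criterion. *)
Definition controllable n k (A : 'M[C]_n) (B : 'M[C]_(n, k)) :=
  forall (x : 'rV_n) a, x *m A = a *: x -> x *m B = 0 -> x = 0.

(** An unobservable eigenvector can be factored out of the state space: the
    functionals that vanish on it form an invariant space containing the rows of
    the output matrix, and they realize T with a smaller state. *)
Lemma minimal_observable n k l (T : 'M[F]_(l, k)) (A : 'M[C]_n) B Cm D :
  minimal_realization T A B Cm D -> observable A Cm.
Proof.
move=> [Treal Tmin] v a Av Cv; apply/eqP; apply: contraT => v0.
have [r [L [r_lt _ Lv Lspan]]] := kernel_basis v0.
have [A' LA] : exists A', L *m A = A' *m L.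
  by apply: Lspan; rewrite -mulmxA Av -scalemxAr Lv scaler0.
have [C' CL] := Lspan _ Cm Cv.
have comm : cst L *m invmx (z%:M - cst A) = invmx (z%:M - cst A') *m cst L.
  apply: (canRL (mulKmx (resolvent_unit A'))).
  rewrite mulmxA; apply: (canLR (mulmxK (resolvent_unit A))).
  by rewrite mulmxBl mulmxBr -!cstM LA mul_scalar_mx mul_mx_scalar.
have := Tmin _ A' (L *m B) C' D; rewrite leqNgt r_lt.
apply; rewrite /realizes Treal /transfer; congr (_ + _).
by rewrite {1}CL !cstM -[_ *m cst L *m _]mulmxA comm !mulmxA.
Qed.

(** Dually, T is realized on the kernel of x, which is invariant and contains the
    columns of the input matrix. *)
Lemma minimal_controllable n k l (T : 'M[F]_(l, k)) (A : 'M[C]_n) B Cm D :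
  minimal_realization T A B Cm D -> controllable A B.
Proof.
move=> [Treal Tmin] x a xA xB; apply/eqP; apply: contraT; move=> x0.
have [r [E [r_lt _ xE Espan]]] := kernel_basis_col x0.
have [A' AE] : exists A', A *m E = E *m A'.
  by apply: Espan; rewrite mulmxA xA -scalemxAl xE scaler0.
have [B' BE] := Espan _ B xB.
have comm : invmx (z%:M - cst A) *m cst E = cst E *m invmx (z%:M - cst A').
  apply: (canRL (mulmxK (resolvent_unit A'))).
  rewrite -mulmxA; apply: (canLR (mulKmx (resolvent_unit A))).
  by rewrite mulmxBl mulmxBr -!cstM AE mul_scalar_mx mul_mx_scalar.
have := Tmin _ A' B' (Cm *m E) D; rewrite leqNgt r_lt.
apply; rewrite /realizes Treal /transfer; congr (_ + _).
by rewrite {1}BE !cstM -[_ *m cst E *m _]mulmxA -comm !mulmxA.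
Qed.

Lemma feedback_resolvent n l (A : 'M[F]_n) (Cm : 'M_(l, n)) (N : 'M_(n, l)) :
  z%:M - A \in unitmx -> z%:M - (A + N *m Cm) \in unitmx ->
  invmx (z%:M - (A + N *m Cm)) = invmx (z%:M - A) +
    invmx (z%:M - (A + N *m Cm)) *m N *m Cm *m invmx (z%:M - A).
Proof.
move=> uA uA'; have := mulVmx uA'; move: (invmx (z%:M - (A + _))) => R'.
rewrite opprD addrA mulmxBr => /(canRL (subrK _)) e.
rewrite -[R' in LHS](mulmxK uA) e mulmxDl mul1mx.
by rewrite !mulmxA.
Qed.

Lemma transfer_feedback n k l r (A : 'M[F]_n) (B : 'M_(n, k)) (Cm : 'M_(l, n)) D
    (N : 'M_(n, l)) (P : 'M_(r, l)) :
  z%:M - A \in unitmx -> z%:M - (A + N *m Cm) \in unitmx ->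
  transfer (A + N *m Cm) (B + N *m D) (P *m Cm) (P *m D) =
  transfer (A + N *m Cm) N (P *m Cm) P *m transfer A B Cm D.
Proof.
move=> uA uA'; rewrite /transfer.
exact: (feedback_algebra (feedback_resolvent uA uA') B D P).
Qed.

Lemma feedback_inverse n l (A : 'M[F]_n) (Cm : 'M_(l, n)) (N : 'M_(n, l)) :
  z%:M - A \in unitmx -> z%:M - (A + N *m Cm) \in unitmx ->
  transfer (A + N *m Cm) N Cm 1%:M *m transfer A (- N) Cm 1%:M = 1%:M.
Proof.
by move=> uA uA'; exact: feedback_inverse_algebra (feedback_resolvent uA uA').
Qed.

End Realizations.

(** * The all-pass function of a split system *)

Fact para_allpass_algebra (K : fieldType) n l (w : K) (a : 'M[K]_(l, n))
    (y t p q : 'M_n) (c : 'M_(n, l)) : w != 0 -> p *m q = y *m t ->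
  - (- ((1 - w^-1) *: (a *m y)) *m (w *: t *m c)) =
  a *m p *m (- ((1 - w) *: (q *m c))).
Proof.
move=> w0 pq; rewrite mulNmx opprK mulmxN -!scalemxAl -!scalemxAr scalerA.
rewrite -[a *m p *m _]mulmxA [p *m (q *m c)]mulmxA pq !mulmxA -scaleNr.
by congr (_ *: _); rewrite mulrBl mul1r mulVf // opprB.
Qed.

(** Feedback through the first block only keeps the state matrix block
    triangular, so the stable block does not enter the closed-loop gain. *)
Section BlockFeedback.
Variable K : fieldType.
Variables (n1 n2 l : nat) (w : K) (A11 : 'M[K]_n1) (A12 : 'M[K]_(n1, n2)).
Variables (A22 : 'M[K]_n2) (N : 'M[K]_(n1, l)).
Variables (C1 : 'M[K]_(l, n1)) (C2 : 'M[K]_(l, n2)).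

Lemma block_feedbackE :
  block_mx A11 A12 0 A22 + col_mx N 0 *m row_mx C1 C2 =
  block_mx (A11 + N *m C1) (A12 + N *m C2) 0 A22.
Proof. by rewrite mul_col_row !mul0mx add_block_mx !addr0. Qed.

Let pencil := w%:M - (block_mx A11 A12 0 A22 + col_mx N 0 *m row_mx C1 C2).

Lemma block_pencilE : pencil =
  block_mx (w%:M - (A11 + N *m C1)) (- (A12 + N *m C2)) 0 (w%:M - A22).
Proof.
rewrite /pencil block_feedbackE scalar_mx_block opp_block_mx add_block_mx.
by rewrite !sub0r oppr0.
Qed.

Hypotheses (u1 : w%:M - (A11 + N *m C1) \in unitmx) (u2 : w%:M - A22 \in unitmx).

Lemma block_pencil_unit : pencil \in unitmx.
Proof.
rewrite block_pencilE unitmxE det_ublock unitrM -!unitmxE.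
by rewrite u1 u2.
Qed.

Lemma block_pencil_col :
  invmx pencil *m col_mx N 0 = col_mx (invmx (w%:M - (A11 + N *m C1)) *m N) 0.
Proof.
apply: (canLR (mulKmx block_pencil_unit)).
by rewrite block_pencilE mul_block_col !mulmx0 mul0mx !addr0 mulKVmx.
Qed.

End BlockFeedback.

Section AllPass.
Variable C : numClosedFieldType.
Local Notation F := (ratfun C).
Local Notation cst := (map_mx (@rconst C)).
Local Notation z := (rvar C).
Variables (l k : nat) (S : split_system C l k) (X : 'M[C]_(nu S)).
Local Notation A := (Au S).
Local Notation Cm := (Cu S).
Local Notation M := (M_of X).
Hypothesis A_antistable : antistable A.
Hypothesis XX : X^t* = X.
Hypothesis Xu : X \in unitmx.
Hypothesis XE : X - A^t* *m X *m A = Cm^t* *m Cm.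

(** The constant factor in M = - stein_gain Cu^*; it is also the left factor of
    the closed-loop pencil. *)
Definition stein_gain : 'M[C]_(nu S) := invmx X *m invmx (1%:M - A^t*).
Local Notation Y := stein_gain.

Lemma subr1A_unit : 1%:M - A \in unitmx.
Proof. by apply: antistable_subr1 A_antistable _; rewrite normr1. Qed.

Lemma subr1Ac_unit : 1%:M - A^t* \in unitmx.
Proof. by rewrite -[1%:M]ctrmx1 -ctrmxN -ctrmxD ctrmx_unit subr1A_unit. Qed.

Lemma Y_unit : Y \in unitmx.
Proof. by rewrite /stein_gain unitmx_mul !unitmx_inv Xu subr1Ac_unit. Qed.

Lemma YK : Y *m (1%:M - A^t*) *m X = 1%:M.
Proof. by rewrite /stein_gain mulmxKV ?subr1Ac_unit // mulVmx. Qed.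

Lemma M_ofE : M = - (Y *m Cm^t*).
Proof. by rewrite /M_of ctrmx_inv ctrmxD ctrmxN ctrmx1. Qed.

(** Substituting X - A^* X A for Cu^* Cu turns the coefficients of the pencil
    z (I + M Cu) - (A + M Cu) into products. *)
Lemma add1_MC : 1%:M + M *m Cm = - (Y *m A^t* *m X *m (1%:M - A)).
Proof.
rewrite M_ofE mulNmx -[Y *m _ *m Cm]mulmxA -XE -[X in X + _ = _]YK.
rewrite mulmxBr mulmx1 mulmxBl !mulmxBr mulmx1 !mulmxA.
by rewrite !opprB addrC addrA subrK.
Qed.

Lemma addA_MC : A + M *m Cm = - (Y *m X *m (1%:M - A)).
Proof.
rewrite M_ofE mulNmx -[Y *m _ *m Cm]mulmxA -XE -[X in X + _ = _]mul1mx.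
rewrite -[X in X *m _ + _ = _]YK.
rewrite mulmxBr mulmx1 !mulmxBl !mulmxBr mulmx1 !mulmxA.
by rewrite !opprB addrA subrK.
Qed.

(** The closed loop has its poles at the inverses of the conjugates of the
    eigenvalues of A: feedback reflects the unstable poles into the disc. *)
Lemma pencil_factor : z%:M - (cst A + Ru_of X) =
  cst Y *m (1%:M - z *: cst (A^t*)) *m cst (X *m (1%:M - A)).
Proof.
have -> : z%:M - (cst A + Ru_of X) =
    z *: cst (1%:M + M *m Cm) - cst (A + M *m Cm).
  rewrite /Ru_of !cstD cst1 scalerBl scale1r scalerDr scale_scalar_mx mulr1.
  by rewrite !opprD !opprK addrA [RHS]addrACA [- _ + _ *: _]addrC.
rewrite add1_MC addA_MC !cstN opprK scalerN [cst Y *m _]mulmxBr mulmx1 [RHS]mulmxBl addrC.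
by rewrite -scalemxAr -scalemxAl -!cstM !mulmxA.
Qed.

Lemma Ru_ofE : Ru_of X = ((1 - z) *: cst M) *m cst Cm.
Proof. by rewrite /Ru_of cstM scalemxAl. Qed.

(** The point 0 is included because evaluation there shows that the pencil is
    invertible as a rational matrix. *)
Lemma subr_zAc_value a : `|a| >= 1 \/ a = 0 -> 1%:M - a *: A^t* \in unitmx.
Proof.
case=> [a1|->]; last by rewrite scale0r subr0 unitmx1.
have a0 : a != 0 by rewrite -normr_gt0 (lt_le_trans ltr01).
have -> : 1%:M - a *: A^t* = a *: (a^-1%:M - A^t*).
  by rewrite scalerBr scale_scalar_mx divff.
rewrite unitmxZ ?unitfE //.
have -> : a^-1%:M - A^t* = (a^-1^*%:M - A)^t*.
  by rewrite ctrmxD ctrmxN tr_scalar_mx map_scalar_mx /= conjCK.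
rewrite ctrmx_unit; apply: antistable_subr1 A_antistable _.
by rewrite norm_conjC normfV invf_le1 // normr_gt0.
Qed.

Lemma mx_value_pencil a :
  mx_value (z%:M - (cst A + Ru_of X)) (Some a)
    (Y *m (1%:M - a *: A^t*) *m (X *m (1%:M - A))).
Proof.
rewrite pencil_factor; apply: mx_valueM _ (mx_value_cst _ _).
apply: mx_valueM; first exact: mx_value_cst.
apply: mx_valueB; first exact: mx_value1.
by apply: mx_valueZ _ (mx_value_cst _ _); apply: has_value_var.
Qed.

Lemma pencil_value_unit a : `|a| >= 1 \/ a = 0 ->
  Y *m (1%:M - a *: A^t*) *m (X *m (1%:M - A)) \in unitmx.
Proof.
move=> a1; rewrite unitmx_mul (unitmx_mul Y) Y_unit subr_zAc_value //=.
by rewrite (unitmx_mul X) Xu subr1A_unit.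
Qed.

Lemma pencil_unit : z%:M - (cst A + Ru_of X) \in unitmx.
Proof.
by apply: mx_value_unit (mx_value_pencil 0) _; apply: pencil_value_unit; right.
Qed.

Definition allpass : 'M[F]_l :=
  transfer (cst A) (- ((1 - z) *: cst M)) (cst Cm) 1%:M.

Lemma allpass_inverse :
  transfer (cst A + Ru_of X) ((1 - z) *: cst M) (cst Cm) 1%:M *m allpass = 1%:M.
Proof.
rewrite Ru_ofE; apply: feedback_inverse; first exact: resolvent_unit.
by rewrite -Ru_ofE pencil_unit.
Qed.

(** Both sides are I - (1 - z) Cu Y^* E Cu^*, where Y is [stein_gain] and E is the
    inverse of I - z A^*. *)
Lemma para_allpass :
  paramx allpass = transfer (cst A + Ru_of X) ((1 - z) *: cst M) (cst Cm) 1%:M.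
Proof.
have u : 1%:M - z *: cst (A^t*) \in unitmx.
  have : mx_value (1%:M - z *: cst (A^t*)) (Some 0) (1%:M - 0 *: A^t*).
    apply: mx_valueB; first exact: mx_value1.
    by apply: mx_valueZ _ (mx_value_cst _ _); apply: has_value_var.
  by move/mx_value_unit; apply; apply: subr_zAc_value; right.
have WY : X *m (1%:M - A) *m Y^t* = 1%:M.
  rewrite ctrmxM !ctrmx_inv XX ctrmxD ctrmxN ctrmx1 trmxCK mulmxA.
  by rewrite mulmxK ?subr1A_unit // mulmxV.
have pV : invmx (z%:M - (cst A + Ru_of X)) *m cst Y =
    cst (Y^t*) *m invmx (1%:M - z *: cst (A^t*)).
  apply: (canLR (mulKmx pencil_unit)); rewrite pencil_factor mulmxA.
  rewrite -[_ *m cst _ *m cst (Y^t*)]mulmxA -cstM WY cst1 mulmx1.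
  by rewrite mulmxK.
have z0 := rvar_neq0 C.
have pR : paramx (invmx (z%:M - cst A)) = z *: invmx (1%:M - z *: cst (A^t*)).
  have e : paramx (z%:M - cst A) = z^-1 *: (1%:M - z *: cst (A^t*)).
    rewrite scalerBr scalerA mulVf // scale1r scale_scalar_mx mulr1.
    by rewrite paramxD paramxN paramx_scalar paramx_cst para_rvar.
  rewrite paramxV e.
  have h : z^-1 *: (1%:M - z *: cst (A^t*)) \in unitmx.
    have zu : z^-1 \is a GRing.unit by rewrite unitfE invr_eq0.
    rewrite (unitmxZ _ zu); exact: u.
  by rewrite (invmxZ h) invrK.
have pM : paramx ((1 - z) *: cst M) = - ((1 - z^-1) *: (cst Cm *m cst (Y^t*))).
  rewrite M_ofE cstN scalerN paramxN paramxZ rmorphB rmorph1 /= para_rvar.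
  by rewrite paramx_cst ctrmxM trmxCK cstM.
rewrite /allpass /transfer.
have e (a : 'M[F]_(l, nu S)) (b : 'M_(nu S)) (c : 'M_(nu S, l)) :
    paramx (a *m b *m (- c) + 1%:M) =
    - (paramx c *m (paramx b *m paramx a)) + 1%:M.
  by rewrite paramxD paramx1 mulmxN paramxN !paramxM.
rewrite e.
rewrite pM pR paramx_cst M_ofE cstN scalerN cstM.
by rewrite (para_allpass_algebra _ _ z0 pV).
Qed.

Lemma mulmx_para_allpass : paramx allpass *m allpass = 1%:M.
Proof. by rewrite para_allpass allpass_inverse. Qed.

Lemma Q1_ofE (P : 'M[C]_l) : Q1_of X P = (cst P *m paramx allpass)^T.
Proof.
rewrite para_allpass /Q1_of /transfer cstM; congr (_^T).
by rewrite mulmxDr mulmx1 !mulmxA.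
Qed.

(** The feedback gain on the full state, for a rational or a numerical z. *)
Definition gain (K : fieldType) (w : K) (m : 'M[K]_(nu S, l)) :
  'M[K]_(nu S + ns S, l) := col_mx ((1 - w) *: m) 0.

Local Notation fA := (split_A S).
Local Notation fB := (col_mx (Bu S) (Bs S)).
Local Notation fC := (row_mx (Cu S) (Cs S)).
Local Notation fN := (gain z (cst M)).

Lemma cst_splitA : cst fA = block_mx (cst A) (cst (Aus S)) 0 (cst (As S)).
Proof. by rewrite /split_A map_block_mx cst0. Qed.

Lemma full_pencil_unit : z%:M - (cst fA + fN *m cst fC) \in unitmx.
Proof.
rewrite cst_splitA map_row_mx; apply: block_pencil_unit; last exact: resolvent_unit.
by rewrite -Ru_ofE; apply: pencil_unit.
Qed.

Lemma Q1_ofE_full P : (Q1_of X P)^T =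
  transfer (cst fA + fN *m cst fC) fN (cst P *m cst fC) (cst P).
Proof.
rewrite /Q1_of trmxK /transfer; congr (_ + _).
have u := pencil_unit; rewrite Ru_ofE in u.
rewrite -!mulmxA cst_splitA map_row_mx (block_pencil_col _ _ u (resolvent_unit _)).
by rewrite mul_row_col mulmx0 addr0 -Ru_ofE cstM !mulmxA.
Qed.

Lemma W2_ofE_full P : (W2_of X P)^T =
  transfer (cst fA + fN *m cst fC) (cst fB + fN *m cst (Dm S))
    (cst P *m cst fC) (cst P *m cst (Dm S)).
Proof.
rewrite /W2_of trmxK cst_splitA map_row_mx block_feedbackE -cstM map_col_mx.
rewrite mul_col_mx mul0mx add_col_mx addr0 mul_mx_row -!cstM.
by rewrite /Ru_of /Rs_of /RD_of !(cstM M) !scalemxAl.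
Qed.

Lemma W2_ofE P T : realizes T fA fB fC (Dm S) ->
  (W2_of X P)^T = (Q1_of X P)^T *m T.
Proof.
move=> ->; rewrite W2_ofE_full Q1_ofE_full; apply: transfer_feedback.
  exact: resolvent_unit.
exact: full_pencil_unit.
Qed.

Lemma allpass_value a : `|a| <= 1 ->
  mx_value allpass (Some a) (Cm *m invmx (a%:M - A) *m (- ((1 - a) *: M)) + 1%:M).
Proof.
move=> a1; rewrite /allpass /transfer; apply: mx_valueD _ (mx_value1 _); apply: mx_valueM.
  apply: mx_valueM; first exact: mx_value_cst.
  by apply: mx_value_resolvent; apply: antistable_subr1.
apply: mx_valueN; apply: mx_valueZ _ (mx_value_cst _ _).
by apply: has_valueB (has_value1 _) (has_value_var _).
Qed.

(** The product (1 - z) (z I - A)^-1 is proper, with value - I at infinity. *)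
Lemma allpass_inf : exists V, mx_value allpass None V.
Proof.
have h : mx_value ((1 - z) *: invmx (z%:M - cst A)) None ((0 - 1) *: 1%:M).
  have -> : (1 - z) *: invmx (z%:M - cst A)
      = (z^-1 - 1) *: (z *: invmx (z%:M - cst A)).
    by rewrite scalerA mulrBl mul1r mulVf ?rvar_neq0.
  apply: mx_valueZ (mx_value_scaled_resolvent_inf _).
  by apply: has_valueB (has_value_varV _) (has_value1 _).
exists (- (Cm *m ((0 - 1) *: 1%:M) *m M) + 1%:M).
have -> : allpass = - (cst Cm *m ((1 - z) *: invmx (z%:M - cst A)) *m cst M) + 1%:M.
  by rewrite /allpass /transfer mulmxN -!scalemxAr -scalemxAl.
apply: mx_valueD _ (mx_value1 _); apply: mx_valueN.
by apply: mx_valueM _ (mx_value_cst _ _); apply: mx_valueM _ (mx_value_cst _ _) h.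
Qed.

(** K is analytic in the closed disc, and conjugation reflects. *)
Lemma para_allpass_exterior w : ~~ in_open_disc w ->
  exists V, mx_value (paramx allpass) w V.
Proof.
case: w => [b|] /= b1; last first.
  have h0 : `|0 : C| <= 1 by rewrite normr0 ler01.
  by have := mx_value_para (allpass_value h0); rewrite /= eqxx; eexists; eassumption.
have b1' : 1 <= `|b| by rewrite real_leNgt // ?normr_real ?real1.
have b0 : b != 0 by rewrite -normr_gt0 (lt_le_trans ltr01).
have a1 : `|(b^*)^-1| <= 1 by rewrite normfV norm_conjC invf_le1 // normr_gt0.
have bE : reflect_point (Some b) = Some (b^*)^-1 by rewrite /= (negPf b0).
have := mx_value_para (allpass_value a1); rewrite -bE reflect_pointK.
by eexists; eassumption.
Qed.

Lemma para_allpass_at1 : mx_value (paramx allpass) (Some 1) 1%:M.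
Proof.
have h1 : `|1 : C| <= 1 by rewrite normr1.
have := mx_value_para (allpass_value h1).
by rewrite /= oner_eq0 rmorph1 invr1 subrr scale0r oppr0 mulmx0 add0r ctrmx1.
Qed.

(** At a finite point outside the open disc the unstable poles of T may occur, so
    the values are computed from the closed-loop realizations. *)
Section AtPoint.
Variables (a : C) (P : 'M[C]_l).
Hypotheses (a1 : 1 <= `|a|) (a_As : ~~ eigenvalue (As S) a).

Local Notation fn := (gain a M).
Local Notation fe := (invmx (a%:M - (fA + fn *m fC))).

Lemma full_pencil_value_unit : a%:M - (fA + fn *m fC) \in unitmx.
Proof.
apply: block_pencil_unit; last first.
  by move: a_As; rewrite eigenvalue_unitmx negbK -opprB -scaleN1r unitmxZ ?unitrN1.
rewrite (_ : a%:M - _ = Y *m (1%:M - a *: A^t*) *m (X *m (1%:M - A))).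
  by apply: pencil_value_unit; left.
apply: mx_value_uniq (mx_value_pencil a); rewrite Ru_ofE.
apply: mx_valueB; first by apply: mx_value_scalar; apply: has_value_var.
apply: mx_valueD; first exact: mx_value_cst.
apply: mx_valueM _ (mx_value_cst _ _); apply: mx_valueZ _ (mx_value_cst _ _).
by apply: has_valueB (has_value1 _) (has_value_var _).
Qed.

Lemma mx_value_gain : mx_value fN (Some a) fn.
Proof.
apply: mx_value_col _ (mx_value0 _); apply: mx_valueZ _ (mx_value_cst _ _).
by apply: has_valueB (has_value1 _) (has_value_var _).
Qed.

Lemma full_resolvent_value :
  mx_value (invmx (z%:M - (cst fA + fN *m cst fC))) (Some a) fe.
Proof.
apply: mx_value_inv full_pencil_value_unit.
apply: mx_valueB; first by apply: mx_value_scalar; apply: has_value_var.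
apply: mx_valueD; first exact: mx_value_cst.
by apply: mx_valueM _ (mx_value_cst _ _); apply: mx_value_gain.
Qed.

Lemma Q1_of_value : mx_value (Q1_of X P)^T (Some a) (P *m fC *m fe *m fn + P).
Proof.
rewrite Q1_ofE_full /transfer; apply: mx_valueD _ (mx_value_cst _ _).
apply: mx_valueM _ mx_value_gain; apply: mx_valueM _ full_resolvent_value.
by rewrite -cstM; apply: mx_value_cst.
Qed.

Lemma W2_of_value : mx_value (W2_of X P)^T (Some a)
  (P *m fC *m fe *m (fB + fn *m Dm S) + P *m Dm S).
Proof.
rewrite W2_ofE_full /transfer -!cstM; apply: mx_valueD _ (mx_value_cst _ _).
apply: mx_valueM; first by apply: mx_valueM _ full_resolvent_value; apply: mx_value_cst.
apply: mx_valueD; first exact: mx_value_cst.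
by apply: mx_valueM _ (mx_value_cst _ _); apply: mx_value_gain.
Qed.

(** Put x = u P C e with e the inverse of the closed-loop pencil.  The first
    equation says x n + u P = 0; then the feedback terms drop out of the others,
    leaving x (a I - A) = 0 and x B = 0. *)
Lemma no_common_zero (u : 'rV_l) : controllable fA fB -> P \in unitmx ->
  u *m (P *m fC *m fe *m fn + P) = 0 ->
  u *m (P *m fC *m fe *m (fB + fn *m Dm S) + P *m Dm S) = 0 -> u = 0.
Proof.
move=> ctrb Pu h1 h2.
have [x xE] : exists x, x = u *m P *m fC *m fe by eexists.
have {}h1 : x *m fn + u *m P = 0 by rewrite -h1 mulmxDr !mulmxA xE.
have {}h2 : x *m fB = 0.
  rewrite -h2 mulmxDr !mulmxA -xE mulmxDr mulmxA -addrA -mulmxDl.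
  by rewrite h1 mul0mx addr0.
have xp : x *m (a%:M - (fA + fn *m fC)) = u *m P *m fC.
  by rewrite xE mulmxKV // full_pencil_value_unit.
have x0 : x = 0.
  apply: (ctrb _ a) h2.
  have : x *m (a%:M - fA) = (x *m fn + u *m P) *m fC.
    by rewrite mulmxDl -xp -mulmxA -mulmxDr [X in _ = _ *m X]addrC opprD addrA subrK.
  by rewrite h1 mul0mx mulmxBr mul_mx_scalar => /eqP; rewrite subr_eq0 => /eqP->.
move: h1; rewrite x0 mul0mx add0r => /(congr1 (mulmx^~ (invmx P))).
by rewrite mulmxK // mul0mx.
Qed.

End AtPoint.

End AllPass.

(** * Low rank densities and minimum-phase factors *)

(** The upper rows already have full rank, so they span all the rows. *)
Lemma low_rank_drsub (K : fieldType) m p (Phi : 'M[K]_(m + p)) :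
  \rank Phi = m -> ulsubmx Phi \in unitmx ->
  drsubmx Phi = dlsubmx Phi *m invmx (ulsubmx Phi) *m ursubmx Phi.
Proof.
move=> rk u.
have us : (usubmx Phi <= Phi)%MS.
  apply/row_subP => i; rewrite (_ : row i _ = row (lshift p i) Phi) ?row_sub //.
  by apply/rowP => j; rewrite !mxE.
have ds : (dsubmx Phi <= Phi)%MS.
  apply/row_subP => i; rewrite (_ : row i _ = row (rshift m i) Phi) ?row_sub //.
  by apply/rowP => j; rewrite !mxE.
have rku : \rank (usubmx Phi) = m.
  apply/eqP; rewrite eqn_leq rank_leq_row /=.
  have := mxrankM_maxl (usubmx Phi) (col_mx 1%:M 0).
  rewrite -{1}[usubmx Phi]hsubmxK mul_row_col mulmx1 mulmx0 addr0.
  by rewrite -/(ulsubmx Phi) mxrank_unit.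
have /submxP[L dE] : (dsubmx Phi <= usubmx Phi)%MS.
  apply: submx_trans ds _; rewrite -(geq_leqif (mxrank_leqif_sup us)).
  by rewrite rku rk.
have dlE : dlsubmx Phi = L *m ulsubmx Phi.
  by rewrite /dlsubmx dE -{1}[usubmx Phi]hsubmxK mul_mx_row row_mxKl.
have drE : drsubmx Phi = L *m ursubmx Phi.
  by rewrite /drsubmx dE -{1}[usubmx Phi]hsubmxK mul_mx_row row_mxKr.
by rewrite dlE mulmxK.
Qed.

Section MinimumPhase.
Variable C : numClosedFieldType.
Local Notation F := (ratfun C).
Local Notation cst := (map_mx (@rconst C)).
Local Notation z := (rvar C).

Lemma eq0_on_circle (f : F) :
  (forall a, `|a| = 1 -> has_value f (Some a) 0) -> f = 0.
Proof.
move=> f0; have [p [q [fE q0 _]]] := ratfunP f.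
have [p0|p0] := eqVneq p 0; first by rewrite fE p0 rmorph0 mul0r.
have [a /f0/has_value_finP[p' [q' [e q'a /esym/eqP p'q']]] pa] := unit_circle_non_root p0.
move: p'q'; rewrite mulf_eq0 invr_eq0 (negPf q'a) orbF => /eqP p'a.
have tq0 : tofrac q != 0 by rewrite tofrac_eq0.
rewrite fE in e; have := eq_tofrac_div tq0 (horner_neq0 q'a) e.
move/(congr1 (horner^~ a)); rewrite !hornerM p'a mul0r => /eqP.
by rewrite mulf_eq0 (negPf q'a) (negPf pa).
Qed.

(** Both sides agree on the circle, where the values of Phi are Hermitian. *)
Lemma spectral_density_para n (Phi : 'M[F]_n) :
  spectral_density Phi -> paramx Phi = Phi.
Proof.
move=> Phid; apply/matrixP => i j; apply/eqP; rewrite -subr_eq0; apply/eqP.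
apply: eq0_on_circle => a a1; have [V PV [/is_hermitianmxP VV _]] := Phid a a1.
have := mx_value_para PV; rewrite (reflect_circle a1) => PV'.
rewrite -[X in has_value _ _ X](subrr (V i j)); apply: has_valueB (PV i j).
by have := PV' i j; rewrite -[V^t*]scale1r -(expr0 (-1)) -VV.
Qed.

Lemma exterior_value m n (W : 'M[F]_(m, n)) w : minimum_phase W ->
  ~~ in_open_disc w -> exists V, mx_value W w V.
Proof. by move=> [Wp _] ww; apply: contrapT => /Wp; apply/negP. Qed.

Lemma exterior_full_value m n (W : 'M[F]_(m, n)) w : minimum_phase W ->
  ~~ in_closed_disc w -> exists2 V, mx_value W w V & row_full V.
Proof.
move=> Wmin ww; have [|V WV] := exterior_value Wmin (w := w).
  by apply: contra ww; case: w => //= a /ltW.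
exists V => //; apply: row_full_inj => v Vv0; apply/eqP; apply: contraT => v0.
by case/negP: ww; apply: (proj2 Wmin); exists V, v.
Qed.

Lemma real_norm_cases (a : C) : [\/ `|a| < 1, `|a| = 1 | 1 < `|a|].
Proof.
have [|//|] := real_ltgtP (normr_real a) (real1 C).
- by constructor 1.
- by constructor 3.
- by constructor 2.
Qed.

Lemma exterior_norm (a : C) : ~~ in_closed_disc (Some a) = (1 < `|a|).
Proof. by rewrite /= real_ltNge ?normr_real ?real1. Qed.

(** V = G^-1 W1 is para-unitary and has no poles at all. *)
Lemma minimum_phase_unique m p (G W1 : 'M[F]_m) (H : 'M[F]_(p, m)) :
  minimum_phase (col_mx G (H *m G)) -> minimum_phase (col_mx W1 (H *m W1)) ->
  G \in unitmx -> G *m paramx G = W1 *m paramx W1 ->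
  exists2 U : 'M[C]_m, U \is unitarymx & W1 = G *m cst U.
Proof.
move=> Gmin Wmin Gu GW.
have [V VE] : exists V, V = invmx G *m W1 by eexists.
have GV : G *m V = W1 by rewrite VE (mulKVmx Gu).
have PGu : paramx G \in unitmx by rewrite map_unitmx unitmx_tr.
have VV : V *m paramx V = 1%:M.
  rewrite VE paramxM paramxV mulmxA -[invmx G *m _ *m _]mulmxA -GW.
  by rewrite (mulKmx Gu) (mulmxV PGu).
have VV' : paramx V *m V = 1%:M by apply: mulmx1C.
have VVV : paramx (paramx V) = V.
  have := congr1 (fun Z => V *m paramx Z) VV'.
  by rewrite /= paramxM paramx1 mulmx1 mulmxA VV mul1mx.
have Wfac : col_mx G (H *m G) *m V = col_mx W1 (H *m W1).
  by rewrite mul_col_mx -mulmxA GV.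
have Gfac : col_mx W1 (H *m W1) *m paramx V = col_mx G (H *m G).
  by rewrite -Wfac -mulmxA VV mulmx1.
(* Outside the closed disc both tall factors have values of full column rank, and
   V and V~ carry one to the other. *)
have ext w : ~~ in_closed_disc w ->
    (exists U, mx_value V w U) /\ (exists U, mx_value (paramx V) w U).
  move=> ww; have [g Gg g_full] := exterior_full_value Gmin ww.
  have [h Wh h_full] := exterior_full_value Wmin ww.
  split.
    by apply: (mx_value_cancel Gg g_full (U := h)); rewrite Wfac.
  by apply: (mx_value_cancel Wh h_full (U := g)); rewrite Gfac.
have int w : ~~ in_closed_disc (reflect_point w) -> exists U, mx_value V w U.
  move=> /ext[_ [U /mx_value_para]]; rewrite VVV reflect_pointK.
  by eexists; eassumption.
have [|U VU] := @analytic_everywhere_cst _ _ _ V.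
  case=> [a|]; last by case: (ext None).
  have [a_lt1|a_eq1|a_gt1] := real_norm_cases a.
  - apply: int; rewrite [reflect_point _]/=; have [//|a0] := eqVneq a 0.
    by rewrite exterior_norm normfV norm_conjC invf_gt1 // normr_gt0.
  - exact: analytic_on_circle (esym VV) a_eq1 (mx_value1 _).
  - by case: (ext (Some a)) => //; rewrite exterior_norm.
exists U; last by rewrite -VU GV.
apply/unitarymxP/cst_inj; rewrite cst1 cstM -paramx_cst -VU; exact: VV.
Qed.

End MinimumPhase.

(** * The spectral factors of the density *)

Section SplitStein.
Variable C : numClosedFieldType.
Local Notation F := (ratfun C).
Variables (l k : nat) (T : 'M[F]_(l, k)) (S : split_system C l k).
Hypothesis TS : split_realization T S.

Lemma split_antistable : antistable (Au S).
Proof. by case: TS => _ _ Aup _ a /Aup[_]; rewrite exterior_norm. Qed.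

(** An eigenvector v of Au extends by 0 to one of the whole state matrix. *)
Lemma split_observable : observable (Au S) (Cu S).
Proof.
case: TS => /minimal_observable obs _ _ _ v a Av Cv.
have /(congr1 usubmx) : col_mx v 0 = 0 :> 'cV_(nu S + ns S).
  apply: (obs _ a).
    rewrite /split_A mul_block_col Av !mulmx0 mul0mx !addr0.
    by rewrite scale_col_mx scaler0.
  by rewrite mul_row_col Cv mulmx0 addr0.
by rewrite col_mxKu linear0.
Qed.

Lemma stein_solutionP (X : 'M_(nu S)) :
  stein_solution X <-> X - (Au S)^t* *m X *m Au S = (Cu S)^t* *m Cu S.
Proof.
split=> [[/eqP XE _ _]|XE]; first by move: XE; rewrite subr_eq0 => /eqP.
have CC : ((Cu S)^t* *m Cu S)^t* = (Cu S)^t* *m Cu S by rewrite ctrmxM trmxCK.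
have XX := stein_hermitian split_antistable CC XE.
split; first by rewrite XE subrr.
  by apply/is_hermitianmxP; rewrite expr0 scale1r XX.
apply: (stein_unit split_antistable split_observable XX).
by rewrite -XE addrC subrK.
Qed.

Lemma stein_exists_unique : exists! X, @stein_solution _ _ _ S X.
Proof.
have [X XE] := stein_exists ((Cu S)^t* *m Cu S) split_antistable.
exists X; split=> [|X' /stein_solutionP X'E]; first exact/stein_solutionP.
exact: stein_unique split_antistable XE X'E.
Qed.

Lemma stein_solution_hermitian (X : 'M_(nu S)) : stein_solution X -> X^t* = X.
Proof.
move=> [_ XX _]; have := is_hermitianmxP _ _ _ XX.
by rewrite expr0 scale1r => e; rewrite -e.
Qed.

Lemma stein_solution_unit (X : 'M_(nu S)) : stein_solution X -> X \in unitmx.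
Proof. by move=> [_ _ Xu]; exact: Xu. Qed.

End SplitStein.

Section SpectralFactors.
Variable C : numClosedFieldType.
Local Notation F := (ratfun C).
Local Notation cst := (map_mx (@rconst C)).
Variables (m p : nat) (Phi : 'M[F]_(m + p)) (G1 : 'M[F]_m) (H : 'M[F]_(p, m)).
Hypothesis Phi_density : spectral_density Phi.
Hypothesis Phi_rank : \rank Phi = m.
Hypothesis Phi11_rank : \rank (ulsubmx Phi) = m.
Hypothesis G1_minphase : minimum_phase G1.
Hypothesis G1_factor : spectral_factor (ulsubmx Phi) G1.
Hypothesis H_def : H = dlsubmx Phi *m invmx (ulsubmx Phi).
Local Notation T := (G1^T *m H^T).

Lemma Phi11_unit : ulsubmx Phi \in unitmx.
Proof. by rewrite -row_free_unit /row_free Phi11_rank. Qed.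

Lemma factor_unit (W : 'M[F]_m) : ulsubmx Phi = W *m paramx W -> W \in unitmx.
Proof.
move=> e; have := Phi11_unit; rewrite e (unitmx_mul W) => /andP[Wu _].
exact: Wu.
Qed.

Lemma Phi21E : dlsubmx Phi = H *m ulsubmx Phi.
Proof. by rewrite H_def (mulmxKV Phi11_unit). Qed.

(** The low rank makes the lower right block redundant, and Phi being
    para-Hermitian determines the upper right one. *)
Lemma PhiE : Phi = block_mx (ulsubmx Phi) (ulsubmx Phi *m paramx H)
  (H *m ulsubmx Phi) (H *m ulsubmx Phi *m paramx H).
Proof.
have Phip := spectral_density_para Phi_density.
have ulp : paramx (ulsubmx Phi) = ulsubmx Phi.
  rewrite -[in RHS]Phip; apply/matrixP => i j; by rewrite !mxE.
have urE : ursubmx Phi = ulsubmx Phi *m paramx H.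
  rewrite -ulp -paramxM -Phi21E -[in LHS]Phip.
  by apply/matrixP => i j; rewrite !mxE.
rewrite -{1}[Phi]submxK (low_rank_drsub Phi_rank Phi11_unit) -H_def Phi21E urE.
by rewrite mulmxA.
Qed.

Lemma tall_factor (W1 : 'M[F]_m) : ulsubmx Phi = W1 *m paramx W1 ->
  spectral_factor Phi (col_mx W1 (H *m W1)).
Proof.
move=> e; rewrite /spectral_factor {1}PhiE paramx_col mul_col_row paramxM.
by rewrite e !mulmxA.
Qed.

Lemma factor_tall (W : 'M[F]_(m + p, m)) : spectral_factor Phi W ->
  ulsubmx Phi = usubmx W *m paramx (usubmx W) /\
  W = col_mx (usubmx W) (H *m usubmx W).
Proof.
move=> WE; have e : Phi = col_mx (usubmx W) (dsubmx W) *m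
    row_mx (paramx (usubmx W)) (paramx (dsubmx W)).
  by rewrite -paramx_col vsubmxK.
have ulE : ulsubmx Phi = usubmx W *m paramx (usubmx W).
  by rewrite {1}e mul_col_row block_mxKul.
split=> //; rewrite -{1}[W]vsubmxK; congr col_mx.
have W1u : paramx (usubmx W) \in unitmx.
  by rewrite map_unitmx unitmx_tr (factor_unit ulE).
have := Phi21E; rewrite {1}e mul_col_row block_mxKdl ulE mulmxA.
by move/(congr1 (mulmx^~ (invmx (paramx (usubmx W))))); rewrite !(mulmxK W1u).
Qed.

(** H G1 is a factor of the block Phi22, which is bounded on the circle. *)
Lemma HG1_circle a : `|a| = 1 -> exists V, mx_value (H *m G1) (Some a) V.
Proof.
move=> a1; have [V PV _] := Phi_density a1.
apply: (@analytic_on_circle _ _ _ _ (drsubmx Phi) (drsubmx V)) a1 _ => [|i j].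
  by rewrite {1}PhiE block_mxKdr paramxM G1_factor !mulmxA.
by rewrite !mxE; apply: PV.
Qed.

Section WithSystem.
Variables (S : split_system C m p) (X : 'M[C]_(nu S)).
Hypothesis TS : split_realization T S.
Hypothesis Xstein : stein_solution X.

Let Aas := split_antistable TS.
Let XX := stein_solution_hermitian Xstein.
Let Xu := stein_solution_unit Xstein.
Let XE := (stein_solutionP TS X).1 Xstein.
Let Treal : realizes T (split_A S) (col_mx (Bu S) (Bs S))
  (row_mx (Cu S) (Cs S)) (Dm S).
Proof. by case: TS => -[]. Qed.

(** An eigenvalue of [As] of modulus 1 would be a pole of T on the circle. *)
Lemma As_circle a : 1 <= `|a| -> ~~ eigenvalue (As S) a.
Proof.
move=> a1; apply/negP => aAs; case: TS => _ _ _ /(_ a)[/(_ aAs)[Tpole] /= a1' _].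
have a_eq1 : `|a| = 1 by apply/eqP; rewrite eq_le a1 a1'.
apply: Tpole; have [V /mx_value_tr HV] := HG1_circle a_eq1.
by exists V^T; rewrite -trmx_mul.
Qed.

Lemma W2_of_factor P : W2_of X P = H *m (G1 *m Q1_of X P).
Proof.
apply: trmx_inj; rewrite (W2_ofE Aas Xu XE P Treal).
by rewrite !trmx_mul !mulmxA.
Qed.

Lemma Q1_of_para P : P \is unitarymx -> Q1_of X P *m paramx (Q1_of X P) = 1%:M.
Proof.
move=> /unitarymxP PP; have PP' : P^t* *m P = 1%:M by apply: mulmx1C.
have KK := mulmx1C (mulmx_para_allpass Aas XX Xu XE).
have {}KK : paramx (paramx (allpass X)) *m paramx (allpass X) = 1%:M.
  by rewrite -paramxM KK paramx1.
have paraT (B : 'M[F]_m) : B^T *m paramx B^T = (paramx B *m B)^T.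
  by rewrite trmx_mul; congr (_ *m _); apply/matrixP => i j; rewrite !mxE.
rewrite (Q1_ofE Aas XX Xu XE) paraT paramxM paramx_cst.
rewrite mulmxA -[_ *m cst _ *m cst P]mulmxA -cstM PP' cst1 mulmx1 KK.
exact: trmx1.
Qed.

Lemma Q1_of_exterior P w : ~~ in_open_disc w -> exists V, mx_value (Q1_of X P) w V.
Proof.
move=> /(para_allpass_exterior X Aas)[V KV]; exists (P *m V)^T.
rewrite (Q1_ofE Aas XX Xu XE); apply/mx_value_tr/mx_valueM => //.
exact: mx_value_cst.
Qed.

Lemma Q1_of_at1 P : mx_value (Q1_of X P) (Some 1) P^T.
Proof.
rewrite (Q1_ofE Aas XX Xu XE) -[Y in mx_value _ _ Y^T]mulmx1; apply/mx_value_tr/mx_valueM.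
  exact: mx_value_cst.
exact: para_allpass_at1.
Qed.

(** The value of K at infinity is a right inverse up to P. *)
Lemma Q1_of_inf P V : P \in unitmx -> mx_value (Q1_of X P) None V -> V \in unitmx.
Proof.
move=> Pu QV; have [K Kinf] := allpass_inf X.
have KQ : cst P *m paramx (allpass X) *m allpass X = cst P.
  by rewrite -mulmxA (mulmx_para_allpass Aas XX Xu XE) mulmx1.
have QVt := mx_value_tr QV; rewrite (Q1_ofE Aas XX Xu XE) trmxK in QVt.
have := mx_value_uniq (mx_valueM QVt Kinf).
rewrite KQ => /(_ _ (mx_value_cst P _)) VK.
by move: Pu; rewrite -VK (unitmx_mul V^T) unitmx_tr => /andP[].
Qed.

Definition factor_of P : 'M[F]_(m + p, m) := col_mx (G1 *m Q1_of X P) (W2_of X P).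

(** At infinity T is proper and Q1 is analytic; at finite points the closed-loop
    realization of W2 has no pole. *)
Lemma factor_of_exterior P w : ~~ in_open_disc w ->
  exists g q V2, [/\ mx_value G1 w g, mx_value (Q1_of X P) w q &
    mx_value (W2_of X P) w V2].
Proof.
move=> ww; have [g Gg] := exterior_value G1_minphase ww.
have [q Qq] := Q1_of_exterior P ww; exists g, q.
suff [V2 WV2] : exists V2, mx_value (W2_of X P) w V2 by exists V2.
case: w ww Gg Qq => [a|] ww Gg Qq.
  have a1 : 1 <= `|a| by rewrite real_leNgt ?normr_real ?real1.
  have := mx_value_tr (W2_of_value Aas Xu XE P a1 (As_circle a1)).
  by rewrite trmxK; eexists; eassumption.
have WE : W2_of X P = T^T *m Q1_of X P.
  by rewrite W2_of_factor trmx_mul !trmxK mulmxA.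
have := mx_valueM (mx_value_tr (realizes_proper Treal)) Qq.
by rewrite -WE; eexists; eassumption.
Qed.

(** G1 is invertible in the exterior, so a zero vector v of W satisfies
    Q1 v = 0 and W2 v = 0.  At infinity Q1 is invertible; elsewhere
    [no_common_zero] applies to the transposes. *)
Lemma factor_of_minimum_phase P : P \is unitarymx -> minimum_phase (factor_of P).
Proof.
move=> /unitarymx_unit Pu; split=> w.
  move=> Wp; apply: contraT => ww; case: Wp.
  have [g [q [V2 [Gg Qq WV2]]]] := factor_of_exterior P ww.
  by exists (col_mx (g *m q) V2); apply: mx_value_col WV2; apply: mx_valueM.
move=> [V [v [WV v0 Vv]]]; apply: contraT => ww.
have ww' : ~~ in_open_disc w.
  by apply: contra ww; case: w {WV} => //= a /ltW.
have [g [q [V2 [Gg Qq WV2]]]] := factor_of_exterior P ww'.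
have VE : V = col_mx (g *m q) V2.
  by apply: mx_value_uniq WV _; apply: mx_value_col WV2; apply: mx_valueM.
have gu : g \in unitmx.
  have [g' Gg' g'_full] := exterior_full_value G1_minphase ww.
  by rewrite (mx_value_uniq Gg Gg') -row_full_unit.
have /eqP := Vv; rewrite VE mul_col_mx col_mx_eq0 => /andP[/eqP gqv /eqP V2v].
have qv : q *m v = 0.
  by apply: (can_inj (mulKmx gu)); rewrite mulmxA gqv mulmx0.
suff v_eq0 : v = 0 by rewrite v_eq0 eqxx in v0.
case: w ww ww' Gg Qq WV2 {WV} => [a|] ww ww' Gg Qq WV2; last first.
  have qu := Q1_of_inf Pu Qq.
  by apply: (can_inj (mulKmx qu)); rewrite qv mulmx0.
have a1 : 1 <= `|a| by rewrite real_leNgt ?normr_real ?real1.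
have aAs := As_circle a1.
apply: trmx_inj; rewrite trmx0.
have ctrb := minimal_controllable (let: And4 h _ _ _ := TS in h).
apply: (no_common_zero Aas Xu XE a1 aAs ctrb Pu).
  rewrite -(mx_value_uniq (mx_value_tr Qq) (Q1_of_value Aas Xu XE P a1 aAs)).
  by rewrite -trmx_mul qv trmx0.
rewrite -(mx_value_uniq (mx_value_tr WV2) (W2_of_value Aas Xu XE P a1 aAs)).
by rewrite -trmx_mul V2v trmx0.
Qed.

Lemma factor_ofE P :
  factor_of P = col_mx (G1 *m Q1_of X P) (H *m (G1 *m Q1_of X P)).
Proof. by rewrite /factor_of W2_of_factor. Qed.

Lemma factor_of_top P : P \is unitarymx ->
  ulsubmx Phi = (G1 *m Q1_of X P) *m paramx (G1 *m Q1_of X P).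
Proof.
move=> Pun; rewrite paramxM mulmxA -[G1 *m _ *m _]mulmxA Q1_of_para // mulmx1.
exact: G1_factor.
Qed.

Lemma factor_of_spectral P : P \is unitarymx -> spectral_factor Phi (factor_of P).
Proof. by move=> Pun; rewrite factor_ofE; apply/tall_factor/factor_of_top. Qed.

Lemma factor_of_rank P : P \is unitarymx -> \rank (factor_of P) = m.
Proof.
move=> Pun; apply/eqP; rewrite eqn_leq rank_leq_col /=.
have := mxrankM_maxr (row_mx 1%:M 0) (factor_of P).
rewrite mul_row_col mul1mx mul0mx addr0 mxrank_unit //.
exact: factor_unit (factor_of_top Pun).
Qed.

Lemma Q1_of_mulmx (P U : 'M[C]_m) : Q1_of X P *m cst U = Q1_of X (U^T *m P).
Proof.
rewrite !(Q1_ofE Aas XX Xu XE) cstM -[in RHS]mulmxA [RHS]trmx_mul.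
by congr (_ *m _); rewrite map_trmx trmxK.
Qed.

Lemma spectral_factor_unique (W1 : 'M[F]_m) P : P \is unitarymx ->
  ulsubmx Phi = W1 *m paramx W1 -> minimum_phase (col_mx W1 (H *m W1)) ->
  exists2 U : 'M[C]_m, U \is unitarymx & W1 = G1 *m Q1_of X P *m cst U.
Proof.
move=> Pun W1E Wmin; apply: (minimum_phase_unique _ Wmin).
- by rewrite -factor_ofE; apply: factor_of_minimum_phase.
- exact: factor_unit (factor_of_top Pun).
- by rewrite -W1E -(factor_of_top Pun).
Qed.

Lemma minimum_phase_factorP (W : 'M[F]_(m + p, m)) :
  [/\ minimum_phase W, \rank W = m & spectral_factor Phi W] <->
  exists2 P : 'M[C]_m, P \is unitarymx & W = factor_of P.
Proof.
split=> [[Wmin _ Wfac]|[P Pun ->]]; last first.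
  split; [exact: factor_of_minimum_phase|exact: factor_of_rank|].
  exact: factor_of_spectral.
have [W1E WE] := factor_tall Wfac; rewrite WE in Wmin.
have un1 : 1%:M \is @unitarymx C m m.
  by apply/unitarymxP; rewrite ctrmx1 mulmx1.
have [U Uun UE] := spectral_factor_unique un1 W1E Wmin.
exists U^T; first by rewrite trmx_unitary.
by rewrite WE UE factor_ofE -(mulmxA G1) Q1_of_mulmx mulmx1.
Qed.

End WithSystem.

(** No similarity between the two realizations is constructed: their factors agree
    up to a constant unitary matrix U on the right, and evaluation at z = 1 gives
    P^T U = P^T. *)
Lemma Q1_W2_unique (S S' : split_system C m p) (X : 'M[C]_(nu S))
    (X' : 'M[C]_(nu S')) P : P \is unitarymx ->
  split_realization T S -> split_realization T S' ->
  stein_solution X -> stein_solution X' ->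
  (Q1_of X P, W2_of X P) = (Q1_of X' P, W2_of X' P).
Proof.
move=> Pun TS TS' Xs X's.
have [] := @spectral_factor_unique S X TS Xs (G1 *m Q1_of X' P) P Pun.
- exact: factor_of_top TS' X's P Pun.
- by rewrite -(factor_ofE TS' X's); apply: factor_of_minimum_phase.
move=> U _; rewrite -mulmxA => /(congr1 (mulmx (invmx G1))).
have G1u : G1 \in unitmx := factor_unit G1_factor.
rewrite !(mulKmx G1u) => QE.
have U1 : U = 1%:M.
  have := mx_valueM (Q1_of_at1 TS Xs P) (mx_value_cst U (Some 1)).
  rewrite -QE => /(mx_value_uniq (Q1_of_at1 TS' X's P))/esym.
  have PTu : P^T \in unitmx by rewrite unitmx_tr unitarymx_unit.
  by move/(congr1 (mulmx (invmx P^T))); rewrite (mulKmx PTu) (mulVmx PTu).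
rewrite (W2_of_factor TS Xs) (W2_of_factor TS' X's) QE U1 cst1 mulmx1.
by [].
Qed.

End SpectralFactors.

Local Open Scope complex_scope.

Theorem theorem3p3 (R : realType) (m p : nat) (m_gt0 : (0 < m)%N)
    (Phi : 'M[ratfun R[i]]_(m + p))
    (Phi_density : spectral_density Phi)
    (Phi_rank : \rank Phi = m)
    (Phi11_rank : \rank (ulsubmx Phi) = m)
    (G1 : 'M[ratfun R[i]]_m)
    (G1_minphase : minimum_phase G1)
    (G1_factor : spectral_factor (ulsubmx Phi) G1)
    (H : 'M[ratfun R[i]]_(p, m))
    (H_def : H = dlsubmx Phi *m invmx (ulsubmx Phi))
    (S : split_system R[i] m p)
    (S_realization : split_realization (G1^T *m H^T) S) :
  (exists! X, @stein_solution _ _ _ S X) /\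
  forall X, stein_solution X ->
    (forall W : 'M[ratfun R[i]]_(m + p, m),
       [/\ minimum_phase W, \rank W = m & spectral_factor Phi W] <->
       exists2 P : 'M[R[i]]_m, P \is unitarymx &
         W = col_mx (G1 *m @Q1_of _ _ _ S X P) (@W2_of _ _ _ S X P)) /\
    (forall P : 'M[R[i]]_m, P \is unitarymx ->
       exists! QW : 'M[ratfun R[i]]_m * 'M[ratfun R[i]]_(p, m),
         exists (S' : split_system R[i] m p) (X' : 'M[R[i]]_(nu S')),
           [/\ split_realization (G1^T *m H^T) S', stein_solution X' &
               QW = (Q1_of X' P, W2_of X' P)]).
Proof.
split=> [|X Xs]; first exact: stein_exists_unique S_realization.
split=> [W|P Pun].
  exact: (minimum_phase_factorP Phi_density Phi_rank Phi11_rank G1_minphase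
           G1_factor H_def S_realization Xs W).
exists (Q1_of X P, W2_of X P); split=> [|QW [S' [X' [TS' X's ->]]]].
  by exists S, X.
exact: (Q1_W2_unique Phi_density Phi_rank Phi11_rank G1_minphase G1_factor H_def
         Pun S_realization TS' Xs X's).
Qed.
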